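(* Let $f(z)=z+a_{k+1}z^{k+1}+o(z^{k+1})$, $k\in\mathbb{N}$, $a_{k+1}\ne0$, be a germ of a parabolic diffeomorphism of $(\mathbb{C},0)$, and let $\varepsilon>0$ be fixed. The function $z\mapsto\widetilde{A^{\mathbb{C}}}(S^f(z)_\varepsilon)$ is not analytic on any attracting petal $V_+$ of $f$. The function $z\mapsto\widetilde{A^{\mathbb{C}}}(S^{f^{-1}}(z)_\varepsilon)$ is not analytic on any repelling petal $V_-$ of $f$.
   Context: $V_+$ denotes an attracting Leau-Fatou petal ($f(V_+)\subset V_+$, orbits of $f$ in $V_+$ converge to $0$) and $V_-$ a repelling petal ($f^{-1}(V_-)\subset V_-$, orbits of $f^{-1}$ in $V_-$ converge to $0$). For $z\in V_+$, $S^f(z)=\{f^{\circ n}(z):n\in\mathbb{N}_0\}$; for $z\in V_-$, $S^{f^{-1}}(z)=\{f^{\circ(-n)}(z):n\in\mathbb{N}_0\}$. $U_\varepsilon$ is the $\varepsilon$-neighborhood of $U\subset\mathbb{C}$. The complex measure of a measurable set $U\subset\mathbb{C}$ is $\widetilde{A^{\mathbb{C}}}(U)=A(U)\cdot t(U)$, where $A(U)$ is the area and $t(U)\in\mathbb{C}$ the center of mass, i.e. $\widetilde{A^{\mathbb{C}}}(U)=\iint_U(x+iy)\,dx\,dy$. *)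

(* Defs.v *)
From HB Require Import structures.
From mathcomp Require Import all_boot all_order all_algebra.
From mathcomp Require Import complex.
From mathcomp Require Import all_classical all_reals all_analysis.

Set Implicit Arguments.
Unset Strict Implicit.
Unset Printing Implicit Defensive.

Import Order.TTheory GRing.Theory Num.Theory.
Import numFieldNormedType.Exports.

Local Open Scope classical_set_scope.
Local Open Scope ring_scope.
Local Open Scope complex_scope.

(* Regular copy of R[i]: this alias is what carries the topology and the norm
   of R[i] (as a normed module over itself). *)
Notation Cplx R := (R[i]^o).

(* Complex analyticity on a set: local representability by power series. *)
Definition analytic_on (R : realType) (F : Cplx R -> Cplx R)
    (V : set (Cplx R)) : Prop :=
  forall z0, V z0 -> exists c : nat -> Cplx R,
    \forall z \near z0,
      series (fun n => c n * (z - z0) ^+ n) @ \oo --> F z.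

(* The pair (f, g) represents the germ f(z) = z + a z^(k+1) + o(z^(k+1)) of a
   parabolic diffeomorphism of (C, 0) and its inverse: f is analytic on the
   neighborhood N of 0 and g is the inverse of f : N -> f(N).  The values of f
   off N and of g off f(N) are irrelevant. *)
Definition parabolic_diffeo (R : realType) (k : nat) (a : Cplx R)
    (N : set (Cplx R)) (f g : Cplx R -> Cplx R) : Prop :=
  [/\ open N /\ N 0,
      analytic_on f N,
      (forall z, N z -> g (f z) = z)
    & (fun z : Cplx R => f z - z - a * z ^+ k.+1)
        =o_ (nbhs (0 : Cplx R)) (fun z : Cplx R => z ^+ k.+1)].

(* The order of R[i] makes (a * v ^+ k < 0) say that a v^k is a negative real
   number, i.e. that v is an attracting direction of z + a z^(k+1) + ... *)
Definition attracting_direction (R : realType) (k : nat) (a v : Cplx R) : Prop :=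
  a * v ^+ k < 0.

(* Truncated open sector at 0 bisected by the ray through v, of half-opening
   arctan t and radius r. *)
Definition sector (R : realType) (v : Cplx R) (t r : R) : set (Cplx R) :=
  [set z : Cplx R | [/\ z != 0, `|z| < r%:C
                       & `|complex.Im (z / v)| < t * complex.Re (z / v)]].

(* Attracting petals of h(z) = z + a z^(k+1) + ..., defined on D.  The opening
   of the petal is left free: it contains some sector around the attracting
   direction (for Leau-Fatou petals of opening 2 pi / k, all sectors of smaller
   opening).  Neither connectedness nor simple connectedness is imposed. *)
Definition attracting_petal (R : realType) (k : nat) (a : Cplx R)
    (D : set (Cplx R)) (h : Cplx R -> Cplx R) (V : set (Cplx R)) : Prop :=
  [/\ open V /\ V `<=` D,
      (forall z, V z -> V (h z)),
      (forall z, V z -> (fun n => iter n h z) @ \oo --> (0 : Cplx R))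
    & exists v, attracting_direction k a v /\
        exists t r : R, [/\ 0 < t, 0 < r & sector v t r `<=` V]].

(* The inverse germ is g(z) = z - a z^(k+1) + o(z^(k+1)), defined on f(N). *)
Definition repelling_petal (R : realType) (k : nat) (a : Cplx R)
    (N : set (Cplx R)) (f g : Cplx R -> Cplx R) (V : set (Cplx R)) : Prop :=
  attracting_petal k (- a) (f @` N) g V.

Definition dyn_orbit (R : realType) (h : Cplx R -> Cplx R) (z : Cplx R) :
    set (Cplx R) :=
  range (fun n => iter n h z).

Definition eps_nbhd (R : realType) (e : R) (U : set (Cplx R)) : set (Cplx R) :=
  \bigcup_(s in U) ball s e%:C.

Definition complex_measure (R : realType) (U : set (Cplx R)) : Cplx R :=
  let area := (@lebesgue_measure R \x @lebesgue_measure R)%E in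
  let U2 := [set p : measurableTypeR R * measurableTypeR R |
              U (p.1 +i* p.2)] in
  (\int[area]_(p in U2) p.1) +i* (\int[area]_(p in U2) p.2).

(* Main.v *)
(** Proof idea.  Put D = z - h z, where h is f or its inverse.  The difference
    F z - F (h z) of complex measures is the moment of the part of the disc of
    radius e around z that the discs around the later points of the orbit
    leave uncovered.  If F were analytic, Q z = (F z - F (h z)) / D would be
    holomorphic.  Now Re Q is the integral of the scalar product with D over
    the uncovered part of the disc, divided by |D|^2.  If the orbit were
    straight, only the disc around h z would matter and Re Q would tend to
    kappa, half the area of a disc of radius e, as z -> 0; covering more of
    the disc only lowers it.  On the attracting direction the orbit is
    asymptotically straight and Re Q -> kappa.  Off that direction the step D
    and the position z are not aligned, so that far iterates, which are close
    to 0, cover a definite fraction of the crescent, and Re Q <= kappa - d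
    with d > 0 independent of |z|.  Zooming at 0, the harmonic function Re Q
    would thus violate the maximum principle. *)
Require Import Defs.
From mathcomp Require Import all_boot all_order all_algebra.
From mathcomp Require Import complex.
From mathcomp Require Import all_classical all_reals all_analysis.
From mathcomp Require Import measurable_realfun ring lra.
Import Order.TTheory GRing.Theory Num.Theory.
Import numFieldNormedType.Exports.
Import ComplexField.
Set Implicit Arguments.
Unset Strict Implicit.
Unset Printing Implicit Defensive.
Local Open Scope classical_set_scope.
Local Open Scope ring_scope.
Local Open Scope complex_scope.

(** * Modulus and scalar product on R[i] *)

(** The loss d must not shrink with |z|. The crescent left by the disc around h z has width of order
    |D|, and the integrand, the scalar product with D, is of order |D| too: the loss is a multiple
    of |D|^2, which the division by D turns into a constant. Slopes separate the two regimes. At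
    slope s the position has direction 1 + i s, the step about 1 + i (k + 1) s, and k + 1 >= 2
    leaves a wedge of directions obtuse to the position and acute to the step. At slope 0 nearby
    cones are invariant and contain all steps, so no such wedge of fixed size is covered. On the
    horizontal sides of a rectangle around the attracting direction the wedge costs d, but on the
    vertical sides nothing better than kappa + o(1) is known. The quadratic 2 y^2 - (x - 1)^2
    repairs this: it is strictly subharmonic, and negative on the vertical sides of a rectangle
    twice as wide as high. Holomorphy enters through Taylor expansions of order 2, enough for a mean
    over four points. *)

Definition cmod (R : realType) (z : R[i]) : R :=
  Num.sqrt (complex.Re z ^+ 2 + complex.Im z ^+ 2).

Definition dot (R : realType) (p q : R[i]) : R :=
  complex.Re p * complex.Re q + complex.Im p * complex.Im q.

Section Modulus.
Context {R : realType}.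
Implicit Types (z w : R[i]) (x y r : R).

Lemma ReD z w : complex.Re (z + w) = complex.Re z + complex.Re w.
Proof. by case: z w => [a b] [c d]. Qed.

Lemma ReN z : complex.Re (- z) = - complex.Re z.
Proof. by case: z. Qed.

Lemma ImD z w : complex.Im (z + w) = complex.Im z + complex.Im w.
Proof. by case: z w => [a b] [c d]. Qed.

Lemma ImN z : complex.Im (- z) = - complex.Im z.
Proof. by case: z. Qed.

Lemma normE z : `|z| = (cmod z)%:C.
Proof. by rewrite normc_def. Qed.

Lemma cmod_ge0 z : 0 <= cmod z.
Proof. exact: sqrtr_ge0. Qed.

Lemma cmodM z w : cmod (z * w) = cmod z * cmod w.
Proof. by apply: complexI; rewrite -normE normrM !normE -rmorphM. Qed.

Lemma cmodD z w : cmod (z + w) <= cmod z + cmod w.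
Proof. by rewrite -lecR -normE (le_trans (ler_normD _ _))// !normE -rmorphD. Qed.

Lemma cmodN z : cmod (- z) = cmod z.
Proof. by apply: complexI; rewrite -!normE normrN. Qed.

Lemma cmodB z w : cmod (z - w) = cmod (w - z).
Proof. by rewrite -cmodN opprB. Qed.

Lemma cmodD_sub z w : cmod z - cmod w <= cmod (z + w).
Proof. by rewrite lerBlDr -{1}[z](addrK w) (le_trans (cmodD _ _))// cmodN. Qed.

Lemma cmod0 : cmod (0 : R[i]) = 0.
Proof. by apply: complexI; rewrite -normE normr0. Qed.

Lemma cmod1 : cmod (1 : R[i]) = 1.
Proof. by apply: complexI; rewrite -normE normr1. Qed.

Lemma cmod_eq0 z : (cmod z == 0) = (z == 0).
Proof.
apply/eqP/eqP => [z0|->]; last exact: cmod0.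
by apply/eqP; rewrite -normr_eq0 normE z0.
Qed.

Lemma cmod_gt0 z : (0 < cmod z) = (z != 0).
Proof. by rewrite lt0r cmod_ge0 andbT cmod_eq0. Qed.

Lemma cmodV z : cmod z^-1 = (cmod z)^-1.
Proof.
have [->|z0] := eqVneq z 0; first by rewrite invr0 cmod0 invr0.
have c0 : cmod z != 0 by rewrite cmod_eq0.
by apply: (mulfI c0); rewrite -cmodM !divff// cmod1.
Qed.

Lemma cmodX z n : cmod (z ^+ n) = cmod z ^+ n.
Proof. by elim: n => [|n IH]; rewrite ?expr0 ?cmod1// !exprS cmodM IH. Qed.

Lemma cmodR x : cmod x%:C = `|x|.
Proof. by rewrite /cmod /= expr0n addr0 sqrtr_sqr. Qed.

Lemma sqr_cmod z : cmod z ^+ 2 = dot z z.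
Proof. by rewrite /cmod sqr_sqrtr ?addr_ge0 ?sqr_ge0// /dot -!expr2. Qed.

Lemma dot_ge0 z : 0 <= dot z z.
Proof. by rewrite -sqr_cmod sqr_ge0. Qed.

Lemma cmod_lt z r : 0 < r -> (cmod z < r) = (dot z z < r ^+ 2).
Proof. by move=> r0; rewrite -sqr_cmod ltr_sqr ?nnegrE ?cmod_ge0 ?ltW. Qed.

Lemma cmod_le z r : 0 <= r -> (cmod z <= r) = (dot z z <= r ^+ 2).
Proof. by move=> r0; rewrite -sqr_cmod ler_sqr ?nnegrE ?cmod_ge0. Qed.

Lemma Re_le_cmod z : `|complex.Re z| <= cmod z.
Proof. by rewrite -lecR -normE normc_ge_Re. Qed.

Lemma Im_le_cmod z : `|complex.Im z| <= cmod z.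
Proof.
by rewrite -sqrtr_sqr /cmod ler_sqrt ?addr_ge0 ?sqr_ge0// lerDr sqr_ge0.
Qed.

Lemma cmod_le_ReIm z : cmod z <= `|complex.Re z| + `|complex.Im z|.
Proof.
rewrite cmod_le ?addr_ge0// /dot -!expr2 sqrrD !real_normK ?num_real//.
by rewrite lerD2r lerDl mulrn_wge0// mulr_ge0.
Qed.

Lemma cauchy_schwarz z w : `|dot z w| <= cmod z * cmod w.
Proof.
rewrite -(ger0_norm (mulr_ge0 (cmod_ge0 z) (cmod_ge0 w))) -ler_sqr ?nnegrE//.
rewrite !real_normK ?num_real// exprMn !sqr_cmod /dot.
case: z w => [a b] [c d] /=.
rewrite -subr_ge0 (_ : _ - _ = (a * d - b * c) ^+ 2) ?sqr_ge0//; ring.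
Qed.

Lemma dotC z w : dot z w = dot w z.
Proof. by rewrite /dot mulrC [X in _ + X]mulrC. Qed.

Lemma dotDl z z' w : dot (z + z') w = dot z w + dot z' w.
Proof. case: z z' w => [a b] [c d] [p q]; rewrite /dot /=; ring. Qed.

Lemma dotDr w z z' : dot w (z + z') = dot w z + dot w z'.
Proof. by rewrite dotC dotDl !(dotC w). Qed.

Lemma dotNl z w : dot (- z) w = - dot z w.
Proof. case: z w => [a b] [c d]; rewrite /dot /=; ring. Qed.

Lemma dotNr z w : dot z (- w) = - dot z w.
Proof. by rewrite dotC dotNl dotC. Qed.

Lemma dotMM v z w : dot (v * z) (v * w) = dot v v * dot z w.
Proof. case: v z w => [p q] [a b] [c d]; rewrite /dot /=; ring. Qed.

Lemma ball_cmod (z w : R[i]^o) r : ball z r%:C w <-> cmod (z - w) < r.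
Proof. by rewrite -ball_normE /ball_ /= normE ltcR. Qed.

Lemma nbhs_cmod (z : R[i]^o) (P : set R[i]^o) :
  nbhs z P <-> exists2 r, 0 < r & forall w, cmod (z - w) < r -> P w.
Proof.
split=> [/nbhs_ballP[e /= e0 eP]|[r r0 rP]].
  move: e0; rewrite ltcE /= => /andP[/eqP Ime Ree].
  exists (complex.Re e) => // w zw; apply: eP.
  by rewrite (_ : e = (complex.Re e)%:C) ?ball_cmod//; case: e Ime {Ree zw} => a b /= ->.
by apply/nbhs_ballP; exists r%:C => [/=|w /ball_cmod]; [rewrite ltcR|exact: rP].
Qed.

End Modulus.

(** * Second order Taylor expansions *)

Section PowerSeries.
Context {R : realType}.
Implicit Types (F : R[i] -> R[i]) (z w : R[i]).

Definition partial_sum (c : nat -> R[i]) (w : R[i]) (n : nat) : R[i] :=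
  \sum_(0 <= i < n) c i * w ^+ i.

Lemma partial_sumS c w n :
  partial_sum c w n.+1 = partial_sum c w n + c n * w ^+ n.
Proof. by rewrite /partial_sum big_nat_recr. Qed.

(** Convergence at the single point [rho] already bounds the coefficients: from some rank on, two
    consecutive partial sums are within 1 of the limit, so each term is at most 2; the finitely many
    earlier terms enter [M] as a sum. *)
Lemma analytic_expansion F (V : set R[i]^o) z : analytic_on F V -> V z ->
  exists (c : nat -> R[i]) (M r : R), [/\ 0 < r, 0 <= M,
    (forall n, cmod (c n) * r ^+ n <= M)
  & forall w, cmod w <= r -> forall eps, 0 < eps ->
      exists n0, forall n, (n0 <= n)%N ->
        cmod (F (z + w) - partial_sum c w n) <= eps].
Proof.
move=> aF Vz; have [c /nbhs_cmod[r r0 cF]] := aF z Vz.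
have cv w : cmod w <= r / 2 -> forall eps, 0 < eps ->
    exists n0, forall n, (n0 <= n)%N ->
      cmod (F (z + w) - partial_sum c w n) <= eps.
  move=> wr eps eps0.
  have zw : cmod (z - (z + w)) < r.
    by rewrite opprD addrA subrr sub0r cmodN (le_lt_trans wr)// ltr_pdivrMr// ltr_pMr// ltr1n.
  have /cvgrPdist_le/(_ eps%:C) := cF _ zw.
  rewrite ltcR => /(_ eps0)[n0 _ H]; exists n0 => n /H.
  by rewrite normE lecR /series /= [z + w - z]addrC addKr.
have r20 : 0 < r / 2 by rewrite divr_gt0.
pose rho := (r / 2)%:C : R[i].
have rhoE : cmod rho = r / 2 by rewrite cmodR gtr0_norm.
have [|n0 H] := cv rho _ 1 ltr01; first by rewrite rhoE.
pose M := 2 + \sum_(i < n0) cmod (c i) * (r / 2) ^+ i.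
have t_ge0 i : 0 <= cmod (c i) * (r / 2) ^+ i.
  by rewrite mulr_ge0 ?cmod_ge0// exprn_ge0// ltW.
exists c, M, (r / 2); split => //.
  by rewrite addr_ge0// sumr_ge0.
move=> n; have [nn0|n0n] := ltnP n n0.
  rewrite /M (bigD1 (Ordinal nn0))//= addrCA lerDl addr_ge0//.
  by rewrite sumr_ge0.
rewrite (@le_trans _ _ 2)//; last by rewrite lerDl sumr_ge0.
rewrite -rhoE -cmodX -cmodM.
have -> : c n * rho ^+ n = (F (z + rho) - partial_sum c rho n)
    - (F (z + rho) - partial_sum c rho n.+1) by rewrite partial_sumS; ring.
rewrite (le_trans (cmodD _ _))// cmodN.
by apply: lerD; apply: H => //; exact: leq_trans n0n _.
Qed.

(* What the maximum principle below needs from holomorphy; unlike local power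
   series, it is easily transferred to composites, quotients and inverses. *)
Definition taylor2 F z := exists (c1 c2 : R[i]) (K r : R),
  [/\ 0 < r, 0 <= K & forall w, cmod w < r ->
      cmod (F (z + w) - F z - c1 * w - c2 * w ^+ 2) <= K * cmod w ^+ 3].

Lemma cmodD_le (a b : R[i]) (x y : R) :
  cmod a <= x -> cmod b <= y -> cmod (a + b) <= x + y.
Proof. by move=> ax bY; rewrite (le_trans (cmodD _ _))// lerD. Qed.

Lemma expansion_at0 c a : (forall eps : R, 0 < eps ->
      exists n0, forall n, (n0 <= n)%N ->
        cmod (a - partial_sum c 0 n) <= eps) -> a = c 0%N.
Proof.
move=> H; apply/eqP; rewrite -subr_eq0 -cmod_eq0 eq_le cmod_ge0 andbT.
apply/ler_addgt0Pr => eps /H[n0 /(_ n0.+1 (leqnSn _))].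
rewrite add0r /partial_sum big_nat_recl//= expr0 mulr1 big1 ?addr0//.
by move=> i _; rewrite exprS mul0r mulr0.
Qed.

Lemma cmod_limit_le a b (u : nat -> R[i]) (B : R) :
  (forall eps : R, 0 < eps -> exists n0, forall n, (n0 <= n)%N ->
     cmod (a - u n) <= eps) ->
  (exists n1, forall n, (n1 <= n)%N -> cmod (u n - b) <= B) ->
  cmod (a - b) <= B.
Proof.
move=> H [n1 H1]; apply/ler_addgt0Pr => eps /H[n0 H0].
have -> : a - b = (u (maxn n0 n1) - b) + (a - u (maxn n0 n1)) by ring.
rewrite (le_trans (cmodD _ _))// lerD//.
  by rewrite H1// leq_maxr.
by rewrite H0// leq_maxl.
Qed.

Lemma coef_term_le (c : R[i]) (M r : R) n w : 0 < r ->
  cmod c * r ^+ n <= M -> cmod (c * w ^+ n) <= M * (cmod w / r) ^+ n.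
Proof.
move=> r0 cM; rewrite cmodM cmodX expr_div_n mulrA ler_pdivlMr ?exprn_gt0//.
by rewrite mulrAC ler_wpM2r// exprn_ge0// cmod_ge0.
Qed.

Lemma analytic_taylor2 F (V : set R[i]^o) z : analytic_on F V -> V z ->
  taylor2 F z.
Proof.
move=> aF Vz; have [c [M [r [r0 M0 cM cF]]]] := analytic_expansion aF Vz.
have Fz : F z = c 0%N.
  apply: expansion_at0 => eps /(cF 0)[|n0 H]; first by rewrite cmod0 ltW.
  by exists n0 => n /H; rewrite addr0.
exists (c 1%N), (c 2%N), (M * 2 / r ^+ 3), (r / 2); split.
- by rewrite divr_gt0.
- by apply: divr_ge0; [exact: mulr_ge0|exact/exprn_ge0/ltW].
move=> w wr; set q := cmod w / r.
have q0 : 0 <= q by rewrite divr_ge0 ?cmod_ge0// ltW.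
have q2 : 2 * q <= 1.
  by rewrite /q mulrA ler_pdivrMr// mul1r mulrC -ler_pdivlMr// ltW.
have -> : F (z + w) - F z - c 1%N * w - c 2%N * w ^+ 2
    = F (z + w) - partial_sum c w 3.
  rewrite !partial_sumS /partial_sum big_geq// Fz expr0 expr1; ring.
have -> : M * 2 / r ^+ 3 * cmod w ^+ 3 = M * (2 * q ^+ 3).
  by rewrite /q expr_div_n; ring.
apply: (@cmod_limit_le _ _ (partial_sum c w)).
  by apply: cF; rewrite (le_trans (ltW wr))//; lra.
exists 3%N => n.
(* The correction -2 q^m closes the induction on the geometric tail: 2 q <= 1 gives q^m <= 2 q^m - 2
   q^(m+1). *)
suff H m : (3 <= m)%N ->
    cmod (partial_sum c w m - partial_sum c w 3) <= M * (2 * q ^+ 3 - 2 * q ^+ m).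
  move=> /H /le_trans; apply; rewrite ler_wpM2l// gerBl.
  by rewrite mulr_ge0// exprn_ge0.
elim: m => // m IHm; rewrite leq_eqVlt => /predU1P[<-|/IHm{}IHm].
  by rewrite !subrr mulr0 cmod0.
rewrite partial_sumS addrAC (le_trans (cmodD _ _))//.
rewrite (le_trans (lerD IHm (coef_term_le w r0 (cM m))))// -mulrDr ler_wpM2l//.
rewrite -/q [q ^+ m.+1]exprS -addrA lerD2l.
have := exprn_ge0 m q0; set p := q ^+ m => p0; nra.
Qed.

Lemma taylor2_lipschitz F z : taylor2 F z -> exists K r : R,
  [/\ 0 < r, 0 <= K & forall w, cmod w < r -> cmod (F (z + w) - F z) <= K * cmod w].
Proof.
move=> [c1 [c2 [K [r [r0 K0 H]]]]].
exists (cmod c1 + cmod c2 + K), (Num.min r 1); split.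
- by rewrite lt_min r0 ltr01.
- by rewrite !addr_ge0// cmod_ge0.
move=> w; rewrite lt_min => /andP[/H wr w1].
have -> : F (z + w) - F z = (F (z + w) - F z - c1 * w - c2 * w ^+ 2) + c1 * w + c2 * w ^+ 2 by ring.
have w0 := cmod_ge0 w; have c20 := cmod_ge0 c2.
have w2 : cmod w ^+ 2 <= cmod w by rewrite expr2 ler_piMl// ltW.
have w3 : cmod w ^+ 3 <= cmod w by rewrite exprS (le_trans _ w2)// expr2 ler_wpM2l.
rewrite (le_trans (cmodD _ _))// (le_trans (lerD (cmodD _ _) (lexx _)))//.
rewrite !cmodM; set E := cmod (_ - _) in wr *; nra.
Qed.

Lemma taylor2_id z : taylor2 id z.
Proof.
exists 1, 0, 0, 1; split => // w _.
by rewrite [X in cmod X](_ : _ = 0) ?cmod0 ?mul0r//; rewrite /=; ring.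
Qed.

Lemma taylor2_affine a b z : taylor2 (fun w => a * w + b) z.
Proof.
exists a, 0, 0, 1; split => // w _.
by rewrite [X in cmod X](_ : _ = 0) ?cmod0 ?mul0r//=; ring.
Qed.

Lemma taylor2B F G z : taylor2 F z -> taylor2 G z ->
  taylor2 (fun w => F w - G w) z.
Proof.
move=> [c1 [c2 [K [r [r0 K0 H]]]]] [d1 [d2 [L [s [s0 L0 H']]]]].
exists (c1 - d1), (c2 - d2), (K + L), (Num.min r s); split.
- by rewrite lt_min r0 s0.
- exact: addr_ge0.
move=> w; rewrite lt_min => /andP[/H wr /H' ws].
rewrite [(K + L) * _]mulrDl (le_trans _ (lerD wr ws))// -[X in _ <= _ + X]cmodN.
by rewrite (le_trans _ (cmodD _ _))// le_eqVlt; apply/orP; left; apply/eqP; congr cmod; ring.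
Qed.

Lemma taylor2M F G z : taylor2 F z -> taylor2 G z ->
  taylor2 (fun w => F w * G w) z.
Proof.
move=> tF tG; have [KF [rF [rF0 KF0 HF]]] := taylor2_lipschitz tF.
move: tF tG => [c1 [c2 [K [r [r0 K0 H]]]]] [d1 [d2 [L [s [s0 L0 H']]]]].
exists (c1 * G z + F z * d1), (c2 * G z + c1 * d1 + F z * d2).
exists (K * cmod (G z) + cmod c1 * cmod d2 + cmod c2 * cmod d1
  + cmod c2 * cmod d2 + (cmod (F z) + KF) * L + K * (cmod d1 + cmod d2)).
exists (Num.min (Num.min (Num.min r s) rF) 1); split.
- by rewrite !lt_min r0 s0 rF0 ltr01.
- by rewrite !(addr_ge0, mulr_ge0, cmod_ge0).
move=> w; rewrite !lt_min => /andP[/andP[/andP[/H wr /H' ws] /HF wF] w1].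
set A := F (z + w) - _ - _ - _ in wr; set B := G (z + w) - _ - _ - _ in ws.
have -> : F (z + w) * G (z + w) - F z * G z - (c1 * G z + F z * d1) * w
    - (c2 * G z + c1 * d1 + F z * d2) * w ^+ 2 =
  A * G z + (c1 * d2) * w ^+ 3 + (c2 * d1) * w ^+ 3 + (c2 * d2) * w ^+ 4
    + F (z + w) * B + A * (d1 * w + d2 * w ^+ 2).
  by rewrite /A /B; ring.
have w0 := cmod_ge0 w.
have [w30 w4 w2] : [/\ 0 <= cmod w ^+ 3, cmod w ^+ 4 <= cmod w ^+ 3 & cmod w ^+ 2 <= 1].
  split; first exact: exprn_ge0.
    by rewrite exprS ler_piMl ?exprn_ge0// ltW.
  by rewrite exprn_ile1// ltW.
have Fw : cmod (F (z + w)) <= cmod (F z) + KF.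
  rewrite -[F (z + w)](subrK (F z)) addrC (le_trans (cmodD _ _))// lerD2l.
  by rewrite (le_trans wF)// ler_piMr// ltW.
set m3 := cmod w ^+ 3 in wr ws w30 w4 *.
rewrite [leRHS](_ : _ = K * m3 * cmod (G z) + cmod c1 * cmod d2 * m3
  + cmod c2 * cmod d1 * m3 + cmod c2 * cmod d2 * m3
  + (cmod (F z) + KF) * (L * m3) + K * m3 * (cmod d1 + cmod d2)); last by ring.
apply: cmodD_le; last first.
  rewrite cmodM; apply: ler_pM; rewrite ?cmod_ge0//.
  apply: (le_trans (cmodD _ _)); rewrite (cmodM d1) (cmodM d2) cmodX.
  by apply: lerD; rewrite ler_piMr ?cmod_ge0// ltW.
apply: cmodD_le; last by rewrite cmodM; apply: ler_pM; rewrite ?cmod_ge0.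
apply: cmodD_le; last by rewrite 2!cmodM cmodX ler_wpM2l// mulr_ge0 ?cmod_ge0.
apply: cmodD_le; last by rewrite 2!cmodM cmodX.
apply: cmodD_le; last by rewrite 2!cmodM cmodX.
by rewrite cmodM; apply: ler_wpM2r; rewrite ?cmod_ge0.
Qed.

End PowerSeries.

Section Taylor2.
Context {R : realType}.
Implicit Types (F G : R[i] -> R[i]) (z w : R[i]).

Lemma taylor2D F G z : taylor2 F z -> taylor2 G z ->
  taylor2 (fun w => F w + G w) z.
Proof.
move=> tF tG.
have -> : (fun w => F w + G w) = (fun w => F w - ((0 * w + 0) - G w)).
  by apply/funext => w; ring.
by apply: taylor2B tF (taylor2B (taylor2_affine _ _ _) tG).
Qed.

Lemma taylor2_cst a z : taylor2 (fun=> a) z.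
Proof.
have -> : (fun=> a) = (fun w => 0 * w + a) by apply/funext => w; ring.
exact: taylor2_affine.
Qed.

(** An error of order 3 is invisible to [taylor2]. Composition thus reduces to sums and products:
    the outer function may be replaced by its Taylor polynomial. *)
Lemma taylor2_perturb F G z (K r : R) : taylor2 G z -> 0 < r -> 0 <= K ->
  F z = G z ->
  (forall w, cmod w < r -> cmod (F (z + w) - G (z + w)) <= K * cmod w ^+ 3) ->
  taylor2 F z.
Proof.
move=> [d1 [d2 [L [s [s0 L0 H']]]]] r0 K0 FG H.
exists d1, d2, (K + L), (Num.min r s); split.
- by rewrite lt_min r0 s0.
- exact: addr_ge0.
move=> w; rewrite lt_min => /andP[/H wr /H' ws].
rewrite [(K + L) * _]mulrDl (le_trans _ (lerD wr ws))//.
rewrite (le_trans _ (cmodD _ _))// le_eqVlt; apply/orP; left; apply/eqP.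
by congr cmod; rewrite FG; ring.
Qed.

Lemma taylor2_comp F G z : taylor2 F (G z) -> taylor2 G z ->
  taylor2 (F \o G) z.
Proof.
move=> [c1 [c2 [K [r [r0 K0 H]]]]] tG.
have [L [s [s0 L0 HL]]] := taylor2_lipschitz tG.
have tu : taylor2 (fun w => G w - G z) z.
  exact: taylor2B tG (taylor2_cst _ _).
pose H2 w := F (G z) + (c1 * (G w - G z) + c2 * ((G w - G z) * (G w - G z))).
apply: (@taylor2_perturb _ H2 z (K * L ^+ 3) (Num.min s (r / (L + 1)))).
- exact: taylor2D (taylor2_cst _ _) (taylor2D (taylor2M (taylor2_cst _ _) tu)
    (taylor2M (taylor2_cst _ _) (taylor2M tu tu))).
- by rewrite lt_min s0 divr_gt0// ltr_wpDl.
- by rewrite mulr_ge0// exprn_ge0.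
- by rewrite /H2 /=; ring.
move=> w; rewrite lt_min => /andP[/HL ws wr].
have ur : cmod (G (z + w) - G z) < r.
  rewrite (le_lt_trans ws)//; move: wr; rewrite ltr_pdivlMr ?ltr_wpDl// mulrC.
  by apply: le_lt_trans; rewrite ler_wpM2r ?cmod_ge0// lerDl.
have := H _ ur; rewrite (addrC (G z)) subrK => {}H.
rewrite -mulrA -exprMn; apply: le_trans (ler_wpM2l K0 (lerXn2r 3 _ _ ws)).
- rewrite (le_trans _ H)// le_eqVlt; apply/orP; left; apply/eqP; congr cmod.
  by rewrite /H2 /=; ring.
- by rewrite nnegrE cmod_ge0.
- by rewrite nnegrE mulr_ge0// cmod_ge0.
Qed.

Lemma taylor2_inv z : z != 0 -> taylor2 (fun w => w^-1) z.
Proof.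
move=> z0; have m0 : 0 < cmod z by rewrite cmod_gt0.
exists (- z^-1 ^+ 2), (z^-1 ^+ 3), (2 * (cmod z)^-1 ^+ 4), (cmod z / 2).
split; first by rewrite divr_gt0.
  by rewrite mulr_ge0// exprn_ge0// invr_ge0 ltW.
move=> w wr; have zw : cmod z / 2 <= cmod (z + w).
  by have := cmodD_sub z w; lra.
have zw0 : z + w != 0.
  by rewrite -cmod_gt0 (lt_le_trans _ zw)// divr_gt0.
have -> : (z + w)^-1 - z^-1 - - z^-1 ^+ 2 * w - z^-1 ^+ 3 * w ^+ 2
    = - (z^-1 ^+ 3 * (z + w)^-1 * w ^+ 3) by field; rewrite z0 zw0.
rewrite cmodN (cmodM _ (w ^+ 3)) (cmodM _ (z + w)^-1) !cmodX !cmodV.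
rewrite ler_wpM2r ?exprn_ge0 ?cmod_ge0//.
have -> : 2 * (cmod z)^-1 ^+ 4 = (cmod z)^-1 ^+ 3 * (cmod z / 2)^-1.
  by field; rewrite gt_eqF.
rewrite ler_wpM2l ?exprn_ge0 ?invr_ge0 ?cmod_ge0// lef_pV2// posrE.
  by rewrite (lt_le_trans _ zw)// divr_gt0.
by rewrite divr_gt0.
Qed.

Lemma taylor2_div F G z : taylor2 F z -> taylor2 G z -> G z != 0 ->
  taylor2 (fun w => F w / G w) z.
Proof.
by move=> tF tG Gz; exact: taylor2M tF (taylor2_comp (taylor2_inv Gz) tG).
Qed.

(** With h = G (z + w) - G z, the expansion of [F] reads w = c1 h + c2 h^2 + O(w^3). Solving it to
    first order gives h = w / c1 + O(w^2), with constant [K1]; inserting this into h^2 gives the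
    second order. *)
Lemma taylor2_inverse F G z : taylor2 F (G z) ->
  (exists L r : R, [/\ 0 < r, 0 <= L & forall w, cmod w < r ->
     F (G (z + w)) = z + w /\ cmod (G (z + w) - G z) <= L * cmod w]) ->
  taylor2 G z.
Proof.
move=> [c1 [c2 [K [r [r0 K0 H]]]]] [L [s [s0 L0 HL]]].
have Fz : F (G z) = z.
  by have [|] := HL 0; rewrite ?cmod0// addr0.
pose E w := w - c1 * (G (z + w) - G z) - c2 * (G (z + w) - G z) ^+ 2.
have HE w : cmod w < Num.min s (r / (L + 1)) -> cmod (E w) <= K * L ^+ 3 * cmod w ^+ 3.
  rewrite lt_min => /andP[/HL[Fw ws] wr].
  have ur : cmod (G (z + w) - G z) < r.
    rewrite (le_lt_trans ws)//; move: wr; rewrite ltr_pdivlMr ?ltr_wpDl// mulrC.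
    by apply: le_lt_trans; rewrite ler_wpM2r ?cmod_ge0// lerDl.
  have := H _ ur; rewrite (addrC (G z)) subrK Fw Fz (_ : z + w - z = w); last by ring.
  move=> {}H.
  rewrite -mulrA -exprMn (le_trans H)// ler_wpM2l// lerXn2r// nnegrE ?cmod_ge0//.
  by rewrite mulr_ge0// cmod_ge0.
(* Were c1 = 0, the Lipschitz bound on [G] would give |w| = O(|w|^2), which fails at a small real
   [t]. *)
have c10 : c1 != 0.
  apply/eqP => c10.
  pose B := cmod c2 * L ^+ 2 + K * L ^+ 3.
  have B0 : 0 <= B by rewrite addr_ge0// mulr_ge0 ?cmod_ge0 ?exprn_ge0.
  pose t := Num.min (Num.min s (r / (L + 1))) (Num.min 1 (B + 1)^-1) / 2.
  have M0 : 0 < Num.min (Num.min s (r / (L + 1))) (Num.min 1 (B + 1)^-1).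
    by rewrite !lt_min s0 ltr01 divr_gt0 ?ltr_wpDl// invr_gt0 ltr_wpDl.
  have t0 : 0 < t by rewrite divr_gt0.
  have tM : t < Num.min (Num.min s (r / (L + 1))) (Num.min 1 (B + 1)^-1).
    by rewrite /t; lra.
  have tc : cmod t%:C = t by rewrite cmodR gtr0_norm.
  move: tM; rewrite lt_min => /andP[tM]; rewrite lt_min => /andP[t1 tB].
  have := HE t%:C; rewrite tc => /(_ tM).
  have [_ Gt] : F (G (z + t%:C)) = z + t%:C /\ cmod (G (z + t%:C) - G z) <= L * t.
    by rewrite -[in L * t]tc; apply: HL; rewrite tc; move: tM; rewrite lt_min => /andP[].
  rewrite /E c10 mul0r subr0 => EE.
  have : t <= cmod (t%:C - c2 * (G (z + t%:C) - G z) ^+ 2) + cmod c2 * (L * t) ^+ 2.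
    rewrite -{1}tc -{1}[t%:C](subrK (c2 * (G (z + t%:C) - G z) ^+ 2)).
    rewrite (le_trans (cmodD _ _))// lerD2l cmodM cmodX ler_wpM2l ?cmod_ge0//.
    by rewrite lerXn2r// nnegrE ?cmod_ge0// mulr_ge0// ltW.
  move=> /le_trans /(_ (lerD EE (lexx _))).
  apply/negP; rewrite -ltNge.
  have t2 : t ^+ 3 <= t ^+ 2 by rewrite exprS ler_piMl ?exprn_ge0 ?ltW.
  apply: (@le_lt_trans _ _ (B * t ^+ 2)).
    have -> : B * t ^+ 2 = K * L ^+ 3 * t ^+ 2 + cmod c2 * (L * t) ^+ 2.
      by rewrite /B; ring.
    by rewrite lerD2r ler_wpM2l// mulr_ge0// exprn_ge0.
  rewrite expr2 mulrA gtr_pMl//.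
  move: tB; rewrite -[(B + 1)^-1]mul1r ltr_pdivlMr ?ltr_wpDl//.
  by nra.
have m0 : 0 < cmod c1 by rewrite cmod_gt0.
pose K1 := (cmod c2 * L ^+ 2 + K * L ^+ 3) / cmod c1.
exists c1^-1, (- (c2 / c1 ^+ 3)).
exists ((cmod c2 * (K1 * (L + (cmod c1)^-1)) + K * L ^+ 3) / cmod c1).
exists (Num.min (Num.min s (r / (L + 1))) 1).
have K10 : 0 <= K1.
  by rewrite divr_ge0 ?cmod_ge0// addr_ge0// mulr_ge0 ?cmod_ge0 ?exprn_ge0.
have L1 : 0 <= L + (cmod c1)^-1 by rewrite addr_ge0// invr_ge0 cmod_ge0.
split.
- by rewrite !lt_min s0 ltr01 divr_gt0 ?ltr_wpDl.
- apply: divr_ge0; last exact: cmod_ge0.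
  apply: addr_ge0; last by rewrite mulr_ge0// exprn_ge0.
  by rewrite mulr_ge0 ?cmod_ge0// mulr_ge0.
move=> w; rewrite lt_min => /andP[wr w1].
have Ew := HE w wr; move: wr; rewrite lt_min => /andP[/HL[_ Gw] _].
pose h := G (z + w) - G z; rewrite -/h in Gw; have hE : E w = w - c1 * h - c2 * h ^+ 2 by [].
have w0 := cmod_ge0 w.
have w32 : cmod w ^+ 3 <= cmod w ^+ 2.
  by rewrite exprS ler_piMl ?exprn_ge0// ltW.
have h2 : cmod h ^+ 2 <= L ^+ 2 * cmod w ^+ 2.
  by rewrite -exprMn lerXn2r// nnegrE ?cmod_ge0// mulr_ge0.
have d1 : cmod (h - c1^-1 * w) <= K1 * cmod w ^+ 2.
  have -> : h - c1^-1 * w = - (c2 * h ^+ 2 + E w) / c1 by rewrite hE; field.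
  rewrite cmodM cmodN cmodV /K1 mulrAC ler_wpM2r ?invr_ge0 ?cmod_ge0//.
  rewrite mulrDl; apply: (le_trans (cmodD _ _)); apply: lerD.
    by rewrite cmodM cmodX -mulrA ler_wpM2l ?cmod_ge0.
  by rewrite (le_trans Ew)// ler_wpM2l// mulr_ge0// exprn_ge0.
have -> : G (z + w) - G z - c1^-1 * w - - (c2 / c1 ^+ 3) * w ^+ 2
   = - (c2 * ((h - c1^-1 * w) * (h + c1^-1 * w)) + E w) / c1.
  by rewrite -/h hE; field.
rewrite cmodM cmodN cmodV [leRHS]mulrAC ler_wpM2r ?invr_ge0 ?cmod_ge0//.
rewrite [leRHS]mulrDl; apply: (le_trans (cmodD _ _)); apply: lerD => //.
rewrite cmodM -mulrA ler_wpM2l ?cmod_ge0// cmodM.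
have -> : K1 * (L + (cmod c1)^-1) * cmod w ^+ 3 =
  K1 * cmod w ^+ 2 * (L * cmod w + (cmod c1)^-1 * cmod w) by ring.
apply: ler_pM; rewrite ?cmod_ge0//.
by apply: (le_trans (cmodD _ _)); rewrite lerD// cmodM cmodV.
Qed.

(** A discrete form of harmonicity: the increments t, -t, i t, -i t have sum 0, and so do their
    squares, hence both Taylor coefficients drop out. *)
Lemma taylor2_four_points F z : taylor2 F z -> exists K r : R,
  [/\ 0 < r, 0 <= K & forall t : R, 0 < t -> t < r ->
    cmod (F (z + t%:C) + F (z - t%:C) + F (z + 'i * t%:C) + F (z - 'i * t%:C)
          - 4 * F z) <= K * t ^+ 3].
Proof.
move=> [c1 [c2 [K [r [r0 K0 H]]]]]; exists (4 * K), r; split => //.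
  exact: mulr_ge0.
move=> t t0 tr.
have tc : cmod t%:C = t by rewrite cmodR gtr0_norm.
have ic : cmod ('i * t%:C) = t.
  by rewrite cmodM tc /cmod /= expr0n expr1n add0r sqrtr1 mul1r.
have := H t%:C; rewrite tc => /(_ tr) H1.
have := H (- t%:C); rewrite cmodN tc => /(_ tr) H2.
have := H ('i * t%:C); rewrite ic => /(_ tr) H3.
have := H (- ('i * t%:C)); rewrite cmodN ic => /(_ tr) H4.
have -> : 4 * K * t ^+ 3 = K * t ^+ 3 + K * t ^+ 3 + K * t ^+ 3 + K * t ^+ 3 by ring.
apply: le_trans (lerD (lerD (lerD H1 H2) H3) H4).
apply: le_trans (lerD (lerD (cmodD _ _) (lexx _)) (lexx _)).
apply: le_trans (lerD (cmodD _ _) (lexx _)); apply: le_trans (cmodD _ _).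
rewrite le_eqVlt; apply/orP; left; apply/eqP; congr cmod.
have i2 := sqr_i R; rewrite !sqrrN !exprMn i2; ring.
Qed.

(** Stated for any 1-Lipschitz [N] since it serves twice: with the real part in the maximum
    principle, and with minus a distance in the local inversion of the germ. *)
Lemma taylor2_continuous (N : R[i] -> R) F (p : R * R) :
  (forall a b, `|N a - N b| <= cmod (a - b)) -> taylor2 F (p.1 +i* p.2) ->
  {for p, continuous (fun p : R * R => N (F (p.1 +i* p.2)))}.
Proof.
move=> NL /taylor2_lipschitz [K [r [r0 K0 H]]].
apply/cvgrPdist_le => eps eps0.
pose d := Num.min r (eps / (K + 1)) / 2.
have m0 : 0 < Num.min r (eps / (K + 1)) by rewrite lt_min r0 divr_gt0// ltr_wpDl.
have d0 : 0 < d by rewrite divr_gt0.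
apply: filterS (nbhsx_ballx p d d0) => q [].

rewrite /ball /= => q1 q2.
rewrite distrC (le_trans (NL _ _))//.
have -> : q.1 +i* q.2 = p.1 +i* p.2 + ((q.1 - p.1) +i* (q.2 - p.2)).
  by apply/eqP; rewrite eq_complex /= !subrKC !eqxx.
set w := (q.1 - p.1) +i* _.
have wm : cmod w < Num.min r (eps / (K + 1)).
  rewrite (le_lt_trans (cmod_le_ReIm _))// /w /= distrC [X in _ + X]distrC.
  by rewrite (lt_le_trans (ltrD q1 q2))// /d; lra.
move: wm; rewrite lt_min => /andP[wr].
rewrite ltr_pdivlMr ?ltr_wpDl// => we.
have := cmod_ge0 w; have := H _ wr; nra.
Qed.

End Taylor2.

(** * A maximum principle *)

Section MaxPrinciple.
Context {R : realType}.

Lemma rectangle_EVT (f : R * R -> R) (a b c d : R) :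
  a <= b -> c <= d ->
  (forall x y, a <= x <= b -> c <= y <= d -> {for (x, y), continuous f}) ->
  exists x0 y0, [/\ a <= x0 <= b, c <= y0 <= d &
    forall x y, a <= x <= b -> c <= y <= d -> f (x, y) <= f (x0, y0)].
Proof.
move=> ab cd cf.
pose A : set (R * R) := `[a, b] `*` `[c, d].
have cA : compact A by apply: compact_setX; exact: segment_compact.
have A0 : A !=set0.
  by exists (a, c); split; rewrite /= in_itv/= lexx.
have cF : {within A, continuous f}.
  apply: continuous_in_subspaceT => -[x y]; rewrite inE => -[/= xab ycd].
  by apply: cf; [move: xab|move: ycd]; rewrite in_itv.
have [[x0 y0]] := compact_EVT_max A0 cA cF.
rewrite inE /A /= => -[/= xab ycd] H.
exists x0, y0; split => [||x y xab' ycd'].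
- by move: xab; rewrite in_itv.
- by move: ycd; rewrite in_itv.
by apply: (H (x, y)); rewrite inE /A; split; rewrite /= in_itv.
Qed.

(* The quadratic is strictly subharmonic, so its sum with a harmonic function
   increases in mean over four symmetric points. *)
Lemma rectangle_max (q : R[i] -> R[i]) (l m A : R) : 0 < l -> 0 < m ->
  (forall x y, `|x - 1| <= l -> `|y| <= l / 2 -> taylor2 q (x +i* y)) ->
  (forall x y, `|x - 1| <= l -> `|y| <= l / 2 -> `|x - 1| = l \/ `|y| = l / 2 ->
     complex.Re (q (x +i* y)) + m * (2 * y ^+ 2 - (x - 1) ^+ 2) <= A) ->
  complex.Re (q 1) <= A.
Proof.
move=> l0 m0 tq bd.
pose f (p : R * R) :=
  complex.Re (q (p.1 +i* p.2)) + m * (2 * p.2 ^+ 2 - (p.1 - 1) ^+ 2).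
have inx x : (1 - l <= x <= 1 + l) = (`|x - 1| <= l).
  by rewrite ler_norml; apply/andP/andP => -[]; split; lra.
have iny y : (- (l / 2) <= y <= l / 2) = (`|y| <= l / 2) by rewrite ler_norml.
have [||x y|x0 [y0 []]] := @rectangle_EVT f (1 - l) (1 + l) (- (l / 2)) (l / 2).
- by lra.
- by lra.
- rewrite inx iny => xl yl; rewrite /f.
  apply: (@continuousD _ R^o _ (fun p : R * R => complex.Re (q (p.1 +i* p.2)))).
    apply: (@taylor2_continuous _ (@complex.Re R) q (x, y)); last exact: tq.
    by move=> a b; rewrite -ReN -ReD; exact: Re_le_cmod.
  apply: cvgM; first exact: cvg_cst.
  apply: cvgB.
    apply: cvgM; first exact: cvg_cst.
    by rewrite !expr2; apply: cvgM; exact: cvg_snd.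
  rewrite !expr2; apply: cvgM; (apply: cvgB; [exact: cvg_fst|exact: cvg_cst]).
rewrite inx iny => xl yl H.
have f1 : complex.Re (q 1) = f (1, 0).
  by rewrite /f /= subrr expr0n mulr0 subrr mulr0 addr0.
rewrite f1 (le_trans (H 1 0 _ _))//.
- by rewrite inx subrr normr0 ltW.
- by rewrite iny normr0; lra.
have [xl'|xl'] := eqVneq `|x0 - 1| l; first by apply: bd => //; left.
have [yl'|yl'] := eqVneq `|y0| (l / 2); first by apply: bd => //; right.
exfalso.
have {xl xl'}: `|x0 - 1| < l by rewrite lt_neqAle xl'.
have {yl yl'}: `|y0| < l / 2 by rewrite lt_neqAle yl'.
rewrite !ltr_norml => /andP[y1 y2] /andP[x1 x2].
have [|K [r [r0 K0 Hq]]] := @taylor2_four_points _ q (x0 +i* y0).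
  by apply: tq; rewrite ler_norml; apply/andP; split; lra.
pose d := Num.min (Num.min r (m / (2 * (K + 1))))
  (Num.min (Num.min (l / 2 - y0) (l / 2 + y0))
           (Num.min (l - (x0 - 1)) (l + (x0 - 1)))).
have K1 : 0 < K + 1 by rewrite ltr_wpDl.
have d0 : 0 < d.
  have mK : 0 < m / (2 * (K + 1)) by rewrite divr_gt0// mulr_gt0.
  by rewrite /d !lt_min r0 mK /=; do ?[apply/andP; split]; lra.
have d2 : 0 < d / 2 by rewrite divr_gt0.
have : d / 2 < d by lra.
set t := d / 2 in d2 *.
rewrite /d !lt_min => /andP[/andP[tr tK] /andP[/andP[t1 t2] /andP[t3 t4]]].
have := Hq _ d2 tr.
have fE x y : complex.Re (q (x +i* y)) = f (x, y) - m * (2 * y ^+ 2 - (x - 1) ^+ 2).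
  by rewrite /f /= addrK.
have e1 : x0 +i* y0 + t%:C = (x0 + t) +i* y0 by apply/eqP; rewrite eq_complex /= addr0 !eqxx.
have e2 : x0 +i* y0 - t%:C = (x0 - t) +i* y0.
  by apply/eqP; rewrite eq_complex /= oppr0 addr0 !eqxx.
have e3 : x0 +i* y0 + 'i * t%:C = x0 +i* (y0 + t).
  by apply/eqP; rewrite eq_complex /=; apply/andP; split; apply/eqP; ring.
have e4 : x0 +i* y0 - 'i * t%:C = x0 +i* (y0 - t).
  by apply/eqP; rewrite eq_complex /=; apply/andP; split; apply/eqP; ring.
rewrite e1 e2 e3 e4 => /(le_trans (Re_le_cmod _)).
rewrite ler_norml => /andP[+ _].
have -> : 4 * q (x0 +i* y0) = q (x0 +i* y0) + q (x0 +i* y0) + q (x0 +i* y0) + q (x0 +i* y0) by ring.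
rewrite !(ReD, ReN) !fE.
have [xin yin] : 1 - l <= x0 <= 1 + l /\ - (l / 2) <= y0 <= l / 2.
  by split; apply/andP; split; lra.
have h1 : f (x0 + t, y0) <= f (x0, y0) by apply: H => //; apply/andP; split; lra.
have h2 : f (x0 - t, y0) <= f (x0, y0) by apply: H => //; apply/andP; split; lra.
have h3 : f (x0, y0 + t) <= f (x0, y0) by apply: H => //; apply/andP; split; lra.
have h4 : f (x0, y0 - t) <= f (x0, y0) by apply: H => //; apply/andP; split; lra.
set f0 := f (x0, y0) in h1 h2 h3 h4 *; set f1' := f _ in h1 *; set f2 := f _ in h2 *.
set f3 := f _ in h3 *; set f4 := f _ in h4 * => HH.
(* At the maximum the four neighbours sum to at most 4 [f0], whereas the quadratic alone adds m (4
   t^2 - 2 t^2) and the harmonic part loses at most K t^3. The choice of [d] makes [t] too small for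
   that. *)
have : 2 * m * t ^+ 2 <= K * t ^+ 3 by lra.
apply/negP; rewrite -ltNge exprS mulrA ltr_pM2r ?exprn_gt0//.
by move: tK; rewrite ltr_pdivlMr ?mulr_gt0//; nra.
Qed.

End MaxPrinciple.

(** * Area and moments of planar sets *)

Notation plane_measure R :=
  (@lebesgue_measure R \x @lebesgue_measure R)%E.
Notation plane R := (measurableTypeR R * measurableTypeR R)%type.

Section Affine.
Context {R : realType}.
Local Notation mu := (@lebesgue_measure R).

(** By uniqueness of Lebesgue measure, half-open intervals suffice. Negative [c] moves the closed
    end to the other side; it is included for the point reflections of [moment_symmetric]. *)
Lemma lebesgue_measure_affine (c b : R) (A : set (measurableTypeR R)) :
  c != 0 -> measurable A ->
  (`|c|%:E * mu ((fun x => c * x + b)%R @^-1` A) = mu A)%E.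
Proof.
move=> c0 mA.
pose phi := (fun x => c * x + b) : measurableTypeR R -> measurableTypeR R.
have mphi : measurable_fun setT phi.
  by apply: measurable_funD => //; exact: measurable_funM.
have nc : (0 <= `|c|) by [].
pose pf : {measure set _ -> \bar R} := pushforward mu phi.
pose m' := mscale (NngNum nc) (pf mphi).
rewrite -[LHS]/(m' A); apply/esym/lebesgue_measure_unique => // _ [[a d]] _ <-.
change (mu `]a, d]%classic = (`|c|%:E * mu (phi @^-1` `]a, d]%classic))%E).
have [c_gt0|c_lt0|] := ltgtP c 0; last by move=> /eqP; rewrite (negbTE c0).
  have -> : phi @^-1` `]a, d] = `[(d - b) / c, (a - b) / c[%classic.
    apply/seteqP; split => x /=; rewrite !in_itv/= /phi => /andP[x1 x2]; apply/andP; split.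
    - by rewrite ler_ndivrMr// lerBrDr mulrC.
    - by rewrite ltr_ndivlMr// ltrBlDr mulrC.
    - by move: x2; rewrite ltr_ndivlMr// ltrBlDr mulrC.
    - by move: x1; rewrite ler_ndivrMr// lerBrDr mulrC.
  rewrite !lebesgue_measure_itv /= !lte_fin ltr_nM2r ?invr_lt0// ltrD2r.
  case: ifPn => _; last by rewrite mule0.
  by rewrite -!EFinB -EFinM; congr (_%:E); rewrite ltr0_norm//; field.
have -> : phi @^-1` `]a, d] = `](a - b) / c, (d - b) / c]%classic.
  apply/seteqP; split => x /=; rewrite !in_itv/= /phi => /andP[x1 x2]; apply/andP; split.
  - by rewrite ltr_pdivrMr// ltrBlDr mulrC.
  - by rewrite ler_pdivlMr// lerBrDr mulrC.
  - by move: x1; rewrite ltr_pdivrMr// ltrBlDr mulrC.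
  - by move: x2; rewrite ler_pdivlMr// lerBrDr mulrC.
rewrite !lebesgue_measure_itv /= !lte_fin ltr_pM2r ?invr_gt0// ltrD2r.
case: ifPn => _; last by rewrite mule0.
by rewrite -!EFinB -EFinM; congr (_%:E); rewrite gtr0_norm//; field.
Qed.

Definition plane_affine (c b1 b2 : R) : plane R -> plane R :=
  fun p => (c * p.1 + b1, c * p.2 + b2).

Lemma measurable_plane_affine c b1 b2 :
  measurable_fun setT (plane_affine c b1 b2).
Proof.
apply/measurable_fun_pairP; split; apply: measurable_funD => //;
  apply: measurable_funM => //.
Qed.

Lemma plane_measure_affine (c b1 b2 : R) (U : set (plane R)) :
  c != 0 -> measurable U ->
  ((c ^+ 2)%:E * plane_measure R (plane_affine c b1 b2 @^-1` U) =
   plane_measure R U)%E.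
Proof.
move=> c0 mU.
have nc : 0 <= c ^+ 2 by exact: sqr_ge0.
pose pf : {measure set _ -> \bar R} := pushforward (plane_measure R) (plane_affine c b1 b2).
pose m' := mscale (NngNum nc) (pf (measurable_plane_affine c b1 b2)).
rewrite -[LHS]/(m' U); apply/esym/product_measure_unique => // A B mA mB.
change ((c ^+ 2)%:E * plane_measure R (((fun x => c * x + b1)%R @^-1` A)
  `*` ((fun x => c * x + b2)%R @^-1` B)) =
  @lebesgue_measure R A * @lebesgue_measure R B)%E.
have m1 b (A' : set (measurableTypeR R)) : measurable A' ->
    measurable ((fun x => c * x + b) @^-1` A' : set (measurableTypeR R)).
  move=> mA'; rewrite -[X in measurable X]setTI.
  apply: (measurable_funD (measurable_funM _ _) _) => //.
rewrite product_measure1E; [|exact: m1|exact: m1].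
rewrite -(lebesgue_measure_affine b1 c0 mA) -(lebesgue_measure_affine b2 c0 mB).
rewrite muleACA -EFinM -real_normK ?num_real// expr2//.
Qed.

End Affine.

Section PlanarSets.
Context {R : realType}.
Implicit Types (U V : set R[i]^o) (D z m : R[i]) (c r : R).
Local Notation mu2 := (plane_measure R).

Definition coords U : set (plane R) := [set p | U (p.1 +i* p.2)].

Definition bounded_measurable U :=
  measurable (coords U) /\ exists M : R, forall p, U p -> cmod p <= M.

Definition area U : R := fine (mu2 (coords U)).

Definition disc z r : set R[i]^o := [set p : R[i]^o | cmod (p - z) < r].

Lemma measurable_lt (f : plane R -> R) c : measurable_fun setT f ->
  measurable [set p | f p < c].
Proof.
move=> mf; rewrite -[X in measurable X]setTI.
have -> : [set p | f p < c] = f @^-1` `]-oo, c[%classic.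
  by apply/seteqP; split => p /=; rewrite in_itv.
exact: mf.
Qed.

Lemma measurable_le (f : plane R -> R) c : measurable_fun setT f ->
  measurable [set p | f p <= c].
Proof.
move=> mf; rewrite -[X in measurable X]setTI.
have -> : [set p | f p <= c] = f @^-1` `]-oo, c]%classic.
  by apply/seteqP; split => p /=; rewrite in_itv.
exact: mf.
Qed.

Lemma measurable_dot D b : measurable_fun setT
  (fun p : plane R => dot (p.1 +i* p.2 - b) D).
Proof.
rewrite (_ : (fun _ => _) = (fun p : plane R =>
  (p.1 - complex.Re b) * complex.Re D + (p.2 - complex.Im b) * complex.Im D)).
  by apply: measurable_funD; apply: measurable_funM => //;
    apply: measurable_funB => //.
by apply/funext => p; rewrite /dot ReD ImD ReN ImN.
Qed.

Lemma measurable_cmod z : measurable_fun setT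
  (fun p : plane R => cmod (p.1 +i* p.2 - z)).
Proof.
pose f (p : plane R) := (p.1 - complex.Re z) ^+ 2 + (p.2 - complex.Im z) ^+ 2.
have mf : measurable_fun setT f.
  by apply: measurable_funD; apply: measurable_funX; apply: measurable_funB.
rewrite (_ : (fun _ => _) = Num.sqrt \o f).
  apply: measurableT_comp mf; apply: continuous_measurable_fun.
  exact: sqrt_continuous.
by apply/funext => p; rewrite /f /cmod /= ReD ImD ReN ImN.
Qed.

Lemma measurable_disc z r : measurable (coords (disc z r)).
Proof. exact: (@measurable_lt _ r (measurable_cmod z)). Qed.

Lemma bounded_measurable_disc z r : bounded_measurable (disc z r).
Proof.
split; first exact: measurable_disc.
exists (r + cmod z) => p /= pz; rewrite -[p](subrK z).
by rewrite (le_trans (cmodD _ _))// lerD2r ltW.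
Qed.

Lemma bounded_measurableS U V : bounded_measurable V ->
  measurable (coords U) -> U `<=` V -> bounded_measurable U.
Proof.
by move=> [_ [M VM]] mU UV; split => //; exists M => p /UV /VM.
Qed.

Lemma bounded_measurableD U V : bounded_measurable U ->
  measurable (coords V) -> bounded_measurable (U `\` V).
Proof.
move=> bU mV; apply: (bounded_measurableS bU); last by move=> p [].
by apply: (measurableD _ mV); case: bU.
Qed.

Lemma bounded_measurableI U V : bounded_measurable U ->
  measurable (coords V) -> bounded_measurable (U `&` V).
Proof.
move=> bU mV; apply: (bounded_measurableS bU); last by move=> p [].
by apply: (measurableI _ _ _ mV); case: bU.
Qed.

Lemma bounded_measurableU U V : bounded_measurable U ->
  bounded_measurable V -> bounded_measurable (U `|` V).
Proof.
move=> [mU [M UM]] [mV [N VN]]; split; first exact: measurableU.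
exists (Num.max M N) => p [/UM|/VN] H; rewrite le_max H ?orbT//.
Qed.

Lemma bounded_measurable_lty U : bounded_measurable U -> (mu2 (coords U) < +oo)%E.
Proof.
move=> [mU [M UM]].
have sub : coords U `<=` `[-M, M]%classic `*` `[-M, M]%classic.
  move=> p /UM pM; split; rewrite /= in_itv/= -ler_norml.
    by rewrite (le_trans _ pM)// (Re_le_cmod (p.1 +i* p.2)).
  by rewrite (le_trans _ pM)// (Im_le_cmod (p.1 +i* p.2)).
apply: (@le_lt_trans _ _ (mu2 (`[-M, M]%classic `*` `[-M, M]%classic))).
  by apply: le_measure => //; rewrite inE//; exact: measurableX.
have MM : (@lebesgue_measure R `[(- M)%R, M]%classic < +oo)%E.
  by rewrite lebesgue_measure_itv /=; case: ifPn => //; rewrite -EFinB ltry.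
rewrite product_measure1E//; apply: lte_mul_pinfty => //.
by rewrite ge0_fin_numE.
Qed.

Lemma area_fin U : bounded_measurable U -> (area U)%:E = mu2 (coords U).
Proof.
move=> bU; rewrite /area fineK// ge0_fin_numE//; exact: bounded_measurable_lty.
Qed.

Lemma area_ge0 U : 0 <= area U.
Proof. exact: fine_ge0. Qed.

Lemma area_le U V : bounded_measurable U -> bounded_measurable V ->
  U `<=` V -> area U <= area V.
Proof.
move=> bU bV UV; rewrite -lee_fin !area_fin//.
apply: le_measure; rewrite ?inE//; first by case: bU.
  by case: bV.
by move=> p /UV.
Qed.

Lemma area_setU U V : bounded_measurable U -> bounded_measurable V ->
  (forall p, U p -> V p -> False) -> area (U `|` V) = area U + area V.
Proof.
move=> bU bV UV; apply: EFin_inj; rewrite EFinD !area_fin//; last first.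
  exact: bounded_measurableU.
rewrite -measureU//; [by case: bU|by case: bV|].
by apply/seteqP; split => // p [/UV].
Qed.

Lemma area_setD U V : bounded_measurable U -> bounded_measurable V ->
  V `<=` U -> area (U `\` V) = area U - area V.
Proof.
move=> bU bV VU; rewrite -[in RHS](setDUK VU) area_setU//.
- by rewrite addrC addKr.
- by apply: bounded_measurableD => //; case: bV.
- by move=> p Vp [].
Qed.

Lemma area_affine U (c : R) (b : R[i]) : c != 0 -> bounded_measurable U ->
  bounded_measurable [set p : R[i]^o | U (c%:C * p + b)] /\
  c ^+ 2 * area [set p : R[i]^o | U (c%:C * p + b)] = area U.
Proof.
move=> c0 bU; set W := [set p : R[i]^o | _].
have WE : coords W = plane_affine c (complex.Re b) (complex.Im b) @^-1` coords U.
  apply/seteqP; split => -[x y]; rewrite /W /coords /plane_affine /=;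
  by case: b {W} => b1 b2; simpc.
have mW : measurable (coords W).
  rewrite WE -[X in measurable X]setTI; apply: measurable_plane_affine => //.
  by case: bU.
have bW : bounded_measurable W.
  split => //; case: bU => _ [M UM].
  exists ((M + cmod b) / `|c|) => p /UM pM; rewrite ler_pdivlMr ?normr_gt0//.
  rewrite mulrC -[`|c|]cmodR -cmodM -[_ * p](addrK b).
  by rewrite (le_trans (cmodD _ _))// cmodN lerD2r.
split => //; apply: EFin_inj; rewrite EFinM !area_fin// WE.
by apply: plane_measure_affine => //; case: bU.
Qed.

End PlanarSets.

Section Moments.
Context {R : realType}.
Implicit Types (U V : set R[i]^o) (D z m : R[i]) (c r : R).
Local Notation mu2 := (plane_measure R).

Definition moment D U : R := dot (complex_measure U) D.

Let lin D m (p : plane R) : R := dot (p.1 +i* p.2 - m) D.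

Let integrable_lin D m U : bounded_measurable U ->
  mu2.-integrable (coords U) (EFin \o lin D m).
Proof.
move=> bU; have [mU [M UM]] := bU.
apply: measurable_bounded_integrable => //.
- exact: (bounded_measurable_lty bU).
- by apply: measurable_funTS; exact: (measurable_dot D m).
exists ((M + cmod m) * cmod D); split; first exact: num_real.
move=> N MN p /UM pM /=; rewrite (le_trans _ (ltW MN))//.
rewrite (le_trans (cauchy_schwarz _ _))// ler_wpM2r ?cmod_ge0//.
by rewrite (le_trans (cmodD _ _))// cmodN lerD2r.
Qed.

Let integrable_cst (k : R) U : bounded_measurable U ->
  mu2.-integrable (coords U) (EFin \o cst k).
Proof.
move=> bU; have [mU _] := bU.
apply: measurable_bounded_integrable => //.
  exact: (bounded_measurable_lty bU).
exists `|k|; split; first exact: num_real.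
by move=> N MN p _ /=; rewrite (le_trans _ (ltW MN)).
Qed.

Let momentE D m U : bounded_measurable U ->
  \int[mu2]_(p in coords U) lin D m p = moment D U - dot m D * area U.
Proof.
move=> bU; have [mU _] := bU.
have i1 : mu2.-integrable (coords U) (EFin \o (fun p : plane R => p.1)).
  rewrite (_ : (fun p : plane R => p.1) = lin 1 0); first exact: integrable_lin.
  by apply/funext => p; rewrite /lin subr0 /dot /= mulr1 mulr0 addr0.
have i2 : mu2.-integrable (coords U) (EFin \o (fun p : plane R => p.2)).
  rewrite (_ : (fun p : plane R => p.2) = lin 'i 0); first exact: integrable_lin.
  by apply/funext => p; rewrite /lin subr0 /dot /= mulr1 mulr0 add0r.
have i1D : mu2.-integrable (coords U) (EFin \o (fun p : plane R => p.1 * complex.Re D)).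
  rewrite (_ : (fun p : plane R => _) = lin (complex.Re D)%:C 0); first exact: integrable_lin.
  by apply/funext => p; rewrite /lin subr0 /dot /= mulr0 addr0.
have i2D : mu2.-integrable (coords U) (EFin \o (fun p : plane R => p.2 * complex.Im D)).
  rewrite (_ : (fun p : plane R => _) = lin ('i * (complex.Im D)%:C) 0);
    first exact: integrable_lin.
  by apply/funext => p; rewrite /lin subr0 /dot /=; ring.
have -> : \int[mu2]_(p in coords U) lin D m p =
    \int[mu2]_(p in coords U) (lin D 0 p - cst (dot m D) p).
  by apply: eq_Rintegral => p _; rewrite /lin dotDl dotNl subr0.
rewrite RintegralB//; [|exact: (integrable_lin D 0 bU)|exact: (integrable_cst (dot m D) bU)].
rewrite Rintegral_cst//; congr (_ - _).
rewrite /moment /complex_measure /dot /= -!RintegralZr//= -RintegralD//.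
by apply: eq_Rintegral => p _; rewrite /lin subr0.
Qed.

Lemma moment_setU D U V : bounded_measurable U -> bounded_measurable V ->
  (forall p, U p -> V p -> False) ->
  moment D (U `|` V) = moment D U + moment D V.
Proof.
move=> bU bV UV; have bUV := bounded_measurableU bU bV.
have E W : bounded_measurable W ->
    moment D W = \int[mu2]_(p in coords W) lin D 0 p.
  by move=> bW; rewrite momentE// /dot !mul0r addr0 mul0r subr0.
rewrite !E// -Rintegral_setU//; [by case: bU|by case: bV|exact: (integrable_lin D 0 bUV)|].
by apply/disj_setPS => p [/UV].
Qed.

Lemma moment_setD D U V : bounded_measurable U -> bounded_measurable V ->
  V `<=` U -> moment D (U `\` V) = moment D U - moment D V.
Proof.
move=> bU bV VU; rewrite -[in RHS](setDUK VU) moment_setU//.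
- by rewrite addrC addKr.
- by apply: bounded_measurableD => //; case: bV.
- by move=> p Vp [].
Qed.

Lemma moment_ge D U c : bounded_measurable U ->
  (forall p, U p -> c <= dot p D) -> c * area U <= moment D U.
Proof.
move=> bU Uc; have [mU _] := bU.
have := momentE D 0 bU; rewrite /dot !mul0r addr0 mul0r subr0 => <-.
rewrite -Rintegral_cst//; apply: le_Rintegral => //.
- exact: (integrable_cst c bU).
- exact: (integrable_lin D 0 bU).
by move=> p /Uc; rewrite /lin subr0.
Qed.

Lemma moment_le D U c : bounded_measurable U ->
  (forall p, U p -> dot p D <= c) -> moment D U <= c * area U.
Proof.
move=> bU Uc; rewrite -lerN2 -mulNr.
have -> : - moment D U = moment (- D) U by rewrite /moment dotNr.
by apply: moment_ge => // p /Uc; rewrite dotNr lerN2.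
Qed.

(** The reflection about [m] preserves [U] and the area and changes the sign of dot (p - m) D, whose
    integral [I] is therefore 0. *)
Lemma moment_symmetric D m U : bounded_measurable U ->
  (forall p, U p -> U (m + m - p)) -> moment D U = dot m D * area U.
Proof.
move=> bU Um; have [mU _] := bU.
apply/eqP; rewrite -subr_eq0 -momentE//; apply/eqP.
set I := Rintegral _ _ _.
suff : I = - I by lra.
pose phi := plane_affine (-1) (complex.Re (m + m)) (complex.Im (m + m)).
have mphi : measurable_fun setT phi by exact: measurable_plane_affine.
pose pf : {measure set _ -> \bar R} := pushforward mu2 phi.
have phiE p : (phi p).1 +i* (phi p).2 = m + m - (p.1 +i* p.2).
  by rewrite /phi /plane_affine; case: m {Um I phi mphi pf} => a b /=; simpc;
    rewrite addrC [- p.2 + _]addrC.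
have pre : phi @^-1` coords U = coords U.
  apply/seteqP; split => p; rewrite /coords /= phiE => /Um //.
  by rewrite subKr.
have E1 : (\int[mu2]_(p in coords U) (lin D m p)%:E =
    \int[pf mphi]_(p in coords U) (lin D m p)%:E)%E.
  apply: (eq_measure_integral (pf mphi)) => A mA _.
  have := @plane_measure_affine _ (-1) (complex.Re (m + m)) (complex.Im (m + m)) A.
  by rewrite oppr_eq0 oner_eq0 sqrrN expr1n mul1e => /(_ isT mA) AE; exact: (esym AE).
have linphi : EFin \o lin D m \o phi = EFin \o (fun p => -1 * lin D m p).
  apply/funext => p; congr (_%:E); rewrite /lin phiE mulN1r -dotNl.
  by congr dot; ring.
have ilin : mu2.-integrable (coords U) (EFin \o lin D m \o phi).
  rewrite linphi (_ : (fun p => _) = lin (- D) m); first exact: integrable_lin.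
  by apply/funext => p; rewrite /lin dotNr mulN1r.
have E2 : (\int[pf mphi]_(p in coords U) (lin D m p)%:E =
    \int[mu2]_(p in coords U) ((EFin \o lin D m) \o phi) p)%E.
  rewrite -[in RHS]pre; apply: (integral_pushforward mphi _ _ mU).
    by apply/measurable_EFinP; exact: (measurable_dot D m).
  by rewrite pre.
transitivity (\int[mu2]_(p in coords U) (-1 * lin D m p)).
  by rewrite /I /Rintegral E1 E2 linphi.
by rewrite RintegralZl; [rewrite mulN1r|exact: mU|exact: (integrable_lin D m bU)].
Qed.

End Moments.

(** * Areas of sectors, shells, crescents and strips *)

Section Sectors.
Context {R : realType}.
Implicit Types (U V W : set R[i]^o) (D z v : R[i]) (c r e : R).

Definition cone W := forall c (q : R[i]^o), 0 < c -> W q -> W (c%:C * q).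

Definition disc_sector W z r : set R[i]^o := [set p : R[i]^o | W (p - z) /\ cmod (p - z) < r].

Lemma disc_sector0 W r (p : R[i]^o) :
  disc_sector W 0 r p <-> W p /\ cmod p < r.
Proof. by rewrite /disc_sector /= subr0. Qed.

Lemma bounded_measurable_shift U z : bounded_measurable U ->
  bounded_measurable [set p : R[i]^o | U (p - z)] /\
  area [set p : R[i]^o | U (p - z)] = area U.
Proof.
move=> bU; have [] := area_affine (- z) (oner_neq0 R) bU.
rewrite expr1n mul1r (_ : [set p : R[i]^o | U (1%:C * p - z)] = [set p : R[i]^o | U (p - z)]) //.
by apply/funext => p /=; rewrite mul1r.
Qed.

Lemma area_disc_sector W z r : cone W -> measurable (coords W) -> 0 < r ->
  bounded_measurable (disc_sector W z r) /\
  area (disc_sector W z r) = r ^+ 2 * area (disc_sector W 0 1).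
Proof.
move=> cW mW r0.
have b0 : bounded_measurable (disc_sector W 0 r).
  rewrite (_ : disc_sector W 0 r = disc 0 r `&` W).
    by apply: bounded_measurableI => //; exact: bounded_measurable_disc.
  by apply/seteqP; split => p []; rewrite /disc_sector /disc /= subr0.
have zE : [set p : R[i]^o | disc_sector W 0 r (p - z)] = disc_sector W z r.
  by apply/funext => p; rewrite /disc_sector /= subr0.
have [bz az] : bounded_measurable (disc_sector W z r) /\
    area (disc_sector W z r) = area (disc_sector W 0 r).
  by rewrite -zE; exact: bounded_measurable_shift.
split; [exact: bz|rewrite az].
have [_ ar] := area_affine 0 (lt0r_neq0 r0) b0.
have cmodr p : cmod (r%:C * p) = r * cmod p by rewrite cmodM cmodR gtr0_norm.
suff E : [set p : R[i]^o | disc_sector W 0 r (r%:C * p + 0)] = disc_sector W 0 1.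
  by rewrite -ar E.
have rC : r%:C * (r^-1)%:C = 1 by rewrite -rmorphM mulfV ?gt_eqF// rmorph1.
apply/seteqP; split => p /=.
  rewrite addr0 => /disc_sector0[Wp]; rewrite cmodr gtr_pMr; last exact: r0.
  move=> p1.
  have rV : 0 < r^-1 by rewrite invr_gt0.
  have := cW _ _ rV Wp; rewrite mulrA [_ * r%:C]mulrC rC mul1r => Wp'.
  by apply/disc_sector0; split; [exact: Wp'|exact: p1].
move=> /disc_sector0[Wp p1]; rewrite addr0; apply/disc_sector0; split; first exact: cW.
by rewrite cmodr gtr_pMr; [exact: p1|exact: r0].
Qed.

Lemma area_disc z r : 0 < r -> area (disc z r) = r ^+ 2 * area (disc 0 1).
Proof.
move=> r0; have dE z' r' : disc z' r' = disc_sector setT z' r'.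
  by apply/seteqP; split => p //= [].
rewrite !dE; apply: (area_disc_sector z _ _ r0).2 => //.
exact: measurableT.
Qed.

Lemma area_disc1_gt0 : 0 < area (disc (0 : R[i]) 1).
Proof.
rewrite -lte_fin area_fin; last exact: bounded_measurable_disc.
pose I : set (measurableTypeR R) := `](- 2^-1), 2^-1[%classic.
have muI : @lebesgue_measure R I = 1%:E.
  rewrite /I lebesgue_measure_itv /= lte_fin ifT; last by lra.
  by rewrite -EFinB; congr (_%:E); lra.
apply: (@lt_le_trans _ _ (plane_measure R (I `*` I))).
  have mI : measurable I by exact: measurable_itv.
  have -> : plane_measure R (I `*` I) = 1%:E.
    apply: etrans (product_measure1E _ _ mI mI) _.
    by apply: etrans (f_equal2 mule muI muI) _; rewrite mule1.
  by rewrite lte_fin.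
apply: le_measure.
- by rewrite inE; apply: measurableX; exact: measurable_itv.
- by rewrite inE; exact: measurable_disc.
move=> [x y] []; rewrite /I /= !in_itv/= => /andP[x1 x2] /andP[y1 y2].
rewrite /coords /disc /= subr0 cmod_lt// /dot /=; nra.
Qed.

Lemma disc_sub z w r s : cmod (z - w) <= r - s -> disc w s `<=` disc z r.
Proof.
move=> zw p; rewrite /disc /= => pw.
have -> : p - z = (p - w) - (z - w) by ring.
by rewrite (le_lt_trans (cmodD _ _))// cmodN; lra.
Qed.

Lemma area_gt0 U z r : bounded_measurable U -> 0 < r -> disc z r `<=` U ->
  0 < area U.
Proof.
move=> bU r0 /(area_le (bounded_measurable_disc z r) bU); apply: lt_le_trans.
by rewrite area_disc// mulr_gt0 ?area_disc1_gt0// exprn_gt0.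
Qed.

(** For s close to r this is a thin shell along the rim, of area proportional to its thickness. Both
    the gain and the loss of covered area inside a crescent are measured with such shells. *)
Lemma area_annular_sector W z r s : cone W -> measurable (coords W) ->
  0 < s -> s <= r ->
  bounded_measurable (disc_sector W z r `\` disc z s) /\
  area (disc_sector W z r `\` disc z s) =
    (r ^+ 2 - s ^+ 2) * area (disc_sector W 0 1).
Proof.
move=> cW mW s0 sr; have r0 := lt_le_trans s0 sr.
have [br ar] := area_disc_sector z cW mW r0.
have [bs as_] := area_disc_sector z cW mW s0.
have -> : disc_sector W z r `\` disc z s = disc_sector W z r `\` disc_sector W z s.
  by apply/seteqP; split => p [[Wp pr] ps]; split => //; [case|move=> ps'; apply: ps].
split; first by apply: bounded_measurableD => //; case: bs.
rewrite area_setD//; first by rewrite ar as_ mulrBl.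
by move=> p [Wp ps]; split => //; exact: lt_le_trans sr.
Qed.

(** With d = |z - w| < e, the disc of radius e - d around [z] lies in the disc around [w], so the
    crescent lies in an annulus of thickness d. For d >= e the area of the whole disc is small
    enough. *)
Lemma area_crescent_le z w e : 0 < e ->
  area (disc z e `\` disc w e) <= 2 * area (disc (0 : R[i]) 1) * e * cmod (z - w).
Proof.
move=> e0; set d := cmod (z - w); have d0 : 0 <= d by exact: cmod_ge0.
have p0 := area_disc1_gt0.
have bz := bounded_measurable_disc z e.
have mw s : measurable (coords (disc w s)) by exact: measurable_disc.
have [ed|de] := leP e d.
  apply: (@le_trans _ _ (area (disc z e))).
    by apply: area_le; [exact: bounded_measurableD|exact: bz|move=> p []].
  rewrite area_disc//; set a := area _ in p0 *.
  have : 0 <= a * e * (2 * d - e) by rewrite mulr_ge0 ?mulr_ge0 ?ltW//; lra.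
  lra.
have ed0 : 0 < e - d by lra.
have sub : disc z (e - d) `<=` disc w e.
  by apply: disc_sub; rewrite cmodB -/d; lra.
apply: (@le_trans _ _ (area (disc z e `\` disc z (e - d)))).
  apply: area_le; [exact: bounded_measurableD| |].
    by apply: bounded_measurableD => //; exact: measurable_disc.
  by move=> p [pz pw]; split => // /sub.
rewrite area_setD//; last 2 first.
- exact: bounded_measurable_disc.
- by apply: disc_sub; rewrite subrr cmod0; lra.
rewrite (area_disc z e0) (area_disc z ed0); set a := area _ in p0 *.
have : 0 <= a * d ^+ 2 by apply: mulr_ge0; [exact: ltW|exact: exprn_ge0].
lra.
Qed.

Lemma measurable_strip v (c : R) :
  measurable (coords [set q : R[i]^o | `|dot q v| <= c]).
Proof.
rewrite (_ : coords _ = [set p : plane R | `|dot (p.1 +i* p.2 - 0) v| <= c]).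
  apply: measurable_le; apply: measurableT_comp => //.
  exact: measurable_dot.
by apply/funext => p; rewrite /coords /= subr0.
Qed.

(* N disjoint translates of a thin strip fit in the disc of radius 2. *)
Lemma area_strip_small v (eps : R) : cmod v = 1 -> 0 < eps -> exists2 s, 0 < s &
  area ([set q : R[i]^o | `|dot q v| <= s] `&` disc 0 1) <= eps.
Proof.
move=> v1 eps0.
pose S s := [set q : R[i]^o | `|dot q v| <= s] `&` disc 0 1.
have bS s : bounded_measurable (S s).
  rewrite /S setIC; apply: bounded_measurableI; first exact: bounded_measurable_disc.
  exact: measurable_strip.
have vv : dot v v = 1 by rewrite -sqr_cmod v1 expr1n.
(* The copies have thickness 2 s and are shifted along [v] by multiples of 3 s, which keeps them
   disjoint. *)
have copies s N : 0 < s -> exists T : set R[i]^o, [/\ bounded_measurable T,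
    area T = N%:R * area (S s), T `<=` disc 0 (1 + 3 * s * N%:R) &
    forall p, T p -> dot p v <= 3 * s * N%:R - 2 * s].
  move=> s0; elim: N => [|N [T [bT aT Td Tv]]].
    exists set0; split => //.
      by split; [exact: measurable0|exists 0].
    by rewrite /area (_ : coords set0 = set0)// measure0 mul0r.
  pose w : R[i] := (3 * s * N%:R)%:C * v.
  have [Tw [bw aw TwE]] : exists Tw : set R[i]^o, [/\ bounded_measurable Tw,
      area Tw = area (S s) & forall p, Tw p -> S s (p - w)].
    by have [bw aw] := bounded_measurable_shift w (bS s); eexists; split; [exact: bw|exact: aw|].
  have wv p : dot (p - w) v = dot p v - 3 * s * N%:R.
    rewrite dotDl dotNl; congr (_ - _); rewrite /w -[RHS]mulr1 -vv.
    by rewrite /dot; case: (v) => a b /=; ring.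
  exists (T `|` Tw); split.
  - exact: bounded_measurableU.
  - apply: etrans (area_setU bT bw _) _; last first.
      by rewrite aT -natr1 mulrDl mul1r aw.
    by move=> p /Tv Tp /TwE[/= ]; rewrite wv ler_norml => /andP[+ _] _; lra.
  - move=> p [/Td|/TwE[_]]; rewrite /disc /= subr0 -natr1; first by nra.
    rewrite subr0 => pw; rewrite -[p](subrK w).
    have cw : cmod w <= 3 * s * N%:R.
      by rewrite cmodM cmodR v1 mulr1 ger0_norm// mulr_ge0// mulr_ge0// ltW.
    apply: le_lt_trans (cmodD _ _) _; apply: lt_le_trans (ltr_leD pw cw) _; nra.
  - move=> p [/Tv|/TwE[/= + _]]; rewrite -natr1; first by nra.
    by rewrite wv ler_norml => /andP[_]; nra.
pose M := 4 * area (disc (0 : R[i]) 1) / eps.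
have M0 : 0 <= M by rewrite divr_ge0 ?ltW// mulr_gt0 ?area_disc1_gt0.
have := archi_boundP M0; set N := Num.bound M => MN.
have N0 : 0 < N%:R :> R by exact: le_lt_trans MN.
(* For this s the bound 1 + 3 s N on the radius is exactly 2, whose disc has 4 times the area of the
   unit disc: hence the 4 in [M]. *)
exists (3 * N%:R)^-1; first by rewrite invr_gt0 mulr_gt0.
have s0 : 0 < (3 * N%:R)^-1 :> R by rewrite invr_gt0 mulr_gt0.
have [T [bT aT Td _]] := copies _ N s0.
have : area T <= area (disc (0 : R[i]) 2).
  apply: area_le; [exact: bT|exact: bounded_measurable_disc|].
  apply: subset_trans Td _; rewrite (_ : 1 + _ = 2) //.
  by field; rewrite gt_eqF.
rewrite aT (area_disc 0 (ltr0n R 2)) => TA; rewrite -(ler_pM2l N0).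
apply: (le_trans TA); move: MN; rewrite /M ltr_pdivrMr//; lra.
Qed.

End Sectors.

(** * Moment of the exposed part of a disc *)

(* Below, D is the first step z - z1 of the orbit and S covers the disc around
   z1; the part of the disc around z outside S is its contribution to the
   neighborhood of the orbit. *)
Section Crescents.
Context {R : realType}.
Implicit Types (U V S : set R[i]^o) (D z m : R[i]) (c r : R).
Variables (z z1 : R[i]) (e : R) (S : set R[i]^o).
Hypotheses (e0 : 0 < e) (mS : measurable (coords S)) (z1S : disc z1 e `<=` S)
  (z1z : dot z1 z1 <= dot z z).

Let D := z - z1.
Let crescent := disc z e `\` disc z1 e.

Let bz : bounded_measurable (disc z e).
Proof. exact: bounded_measurable_disc. Qed.

Let bcrescent : bounded_measurable crescent.
Proof. exact: bounded_measurableD bz (measurable_disc _ _). Qed.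

Let midE : dot (z + z1) D = dot z z - dot z1 z1.
Proof. by rewrite /D; case: (z) (z1) => [a b] [c d]; rewrite /dot /=; ring. Qed.

(* The disc and its intersection with the second one are symmetric about z and
   about the midpoint of z and z1 respectively. *)
Lemma moment_crescent : moment D crescent =
  area (disc 0 e) / 2 * dot D D + area crescent * ((dot z z - dot z1 z1) / 2).
Proof.
pose I := disc z e `&` disc z1 e.
have bI : bounded_measurable I.
  by apply: bounded_measurableI => //; exact: measurable_disc.
have cE : crescent = disc z e `\` I.
  by rewrite /crescent /I setDIr setDv set0U.
have sI : I `<=` disc z e by move=> p [].
have mE : moment D crescent = moment D (disc z e) - moment D I.
  by rewrite cE; exact: moment_setD.
have aE : area crescent = area (disc z e) - area I.
  by rewrite cE; exact: area_setD.
have dE : moment D (disc z e) = dot z D * area (disc z e).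
  apply: moment_symmetric => // p; rewrite /disc /= => pz.
  by rewrite (_ : z + z - p - z = z - p) 1?cmodB//; ring.
pose m : R[i] := 2^-1%:C * (z + z1).
have mm : m + m = z + z1.
  rewrite /m -mulrDl -rmorphD /= (_ : 2^-1 + 2^-1 = 1 :> R) ?mul1r//.
  by field.
have IE : moment D I = dot m D * area I.
  apply: moment_symmetric => // p [pz pz1]; rewrite mm; split; rewrite /disc /=.
    by rewrite (_ : z + z1 - p - z = - (p - z1)) ?cmodN//; ring.
  by rewrite (_ : z + z1 - p - z1 = - (p - z)) ?cmodN//; ring.
have mD : dot m D = (dot z z - dot z1 z1) / 2.
  by rewrite -midE -mm dotDl; field.
have zD : dot z D = dot D D / 2 + (dot z z - dot z1 z1) / 2.
  by rewrite /D; case: (z) (z1) => [a b] [c d]; rewrite /dot /=; field.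
have a0 : area (disc z e) = area (disc 0 e) by rewrite !(area_disc _ e0).
rewrite mE dE IE mD aE zD a0; ring.
Qed.

Let mid_le : (dot z z - dot z1 z1) / 2 <= cmod z * cmod D.
Proof.
rewrite -midE ler_pdivrMr// (le_trans (ler_norm _))// (le_trans (cauchy_schwarz _ _))//.
rewrite [leRHS]mulrAC ler_wpM2r ?cmod_ge0//.
have : cmod z1 <= cmod z by rewrite cmod_le ?cmod_ge0// sqr_cmod.
have := cmodD z z1; lra.
Qed.

Let mid_ge0 : 0 <= (dot z z - dot z1 z1) / 2.
Proof. by rewrite divr_ge0// subr_ge0. Qed.

(** A point of the crescent is closer to [z] than to [z1]. Beyond their bisector the scalar product
    with [D] is at least (|z|^2 - |z1|^2) / 2, which [z1z] makes nonnegative. *)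
Lemma dot_crescent p : crescent p -> 0 <= dot p D.
Proof.
move=> [pz pz1]; apply: le_trans mid_ge0 _; rewrite -midE.
have : dot (p - z) (p - z) <= dot (p - z1) (p - z1).
  rewrite -!sqr_cmod lerXn2r ?nnegrE ?cmod_ge0//.
  by apply: (le_trans (ltW pz)); rewrite leNgt; apply/negP.
rewrite /D; case: (p) (z) (z1) => [a b] [c d] [x y]; rewrite /dot /=; lra.
Qed.

Let bC : bounded_measurable (disc z e `\` S).
Proof. exact: bounded_measurableD. Qed.

Let bcut : bounded_measurable (crescent `&` S).
Proof. exact: bounded_measurableI. Qed.

Let momentC : moment D (disc z e `\` S) = moment D crescent - moment D (crescent `&` S).
Proof.
have -> : disc z e `\` S = crescent `\` (crescent `&` S).
  rewrite /crescent setDIr setDv set0U; apply/seteqP; split => p.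
    by move=> [pz pS]; split => //; split => // /z1S.
  by move=> [[pz _] pS].
by apply: moment_setD => // p [].
Qed.

(** The covered part outside [U] can be ignored, its moment being nonnegative by [dot_crescent]. The
    error in |z| is the second term of [moment_crescent]: an area of order |D| times a midpoint term
    of at most |z| |D|. *)
Lemma moment_exposed_le U c : bounded_measurable U ->
  U `<=` crescent `&` S -> (forall p, U p -> c <= dot p D) ->
  moment D (disc z e `\` S) <= (area (disc 0 e) / 2
    + 2 * area (disc (0 : R[i]) 1) * e * cmod z) * dot D D - c * area U.
Proof.
move=> bU US Uc; rewrite momentC moment_crescent.
have : area crescent * ((dot z z - dot z1 z1) / 2) <=
   2 * area (disc (0 : R[i]) 1) * e * cmod z * dot D D.
  have -> : 2 * area (disc (0 : R[i]) 1) * e * cmod z * dot D D =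
    2 * area (disc (0 : R[i]) 1) * e * cmod D * (cmod z * cmod D).
    by rewrite -sqr_cmod; ring.
  apply: ler_pM => //; first exact: area_ge0.
  exact: area_crescent_le.
have rest : 0 <= moment D ((crescent `&` S) `\` U).
  rewrite -(mul0r (area ((crescent `&` S) `\` U))).
  apply: moment_ge; first by apply: bounded_measurableD => //; case: bU.
  by move=> p [[pc _] _]; exact: dot_crescent.
move=> mid; have -> : moment D (crescent `&` S) =
    moment D U + moment D ((crescent `&` S) `\` U).
  by rewrite moment_setD//; ring.
rewrite [(_ + _) * dot D D]mulrDl; apply: lerB; first by rewrite lerD2l.
by rewrite (le_trans (moment_ge bU Uc))// lerDl.
Qed.

Lemma moment_exposed_ge U : bounded_measurable U ->
  crescent `&` S `<=` U ->
  area (disc 0 e) / 2 * dot D D - (cmod z + e) * cmod D * area U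
  <= moment D (disc z e `\` S).
Proof.
move=> bU SU; rewrite momentC moment_crescent.
have cut : moment D (crescent `&` S) <= (cmod z + e) * cmod D * area (crescent `&` S).
  apply: moment_le => // p [[pz _] _].
  rewrite (le_trans (ler_norm _))// (le_trans (cauchy_schwarz _ _))//.
  rewrite ler_wpM2r ?cmod_ge0// -[p](subrK z) addrC.
  by rewrite (le_trans (cmodD _ _))// lerD2l ltW.
apply: lerB; first by rewrite lerDl mulr_ge0 ?area_ge0.
apply: (le_trans cut); apply: ler_wpM2l; last exact: area_le.
by rewrite mulr_ge0 ?cmod_ge0// addr_ge0 ?cmod_ge0// ltW.
Qed.

End Crescents.

(** * The quotient of consecutive differences, bounded above and below *)

Section OrbitNeighborhoods.
Context {R : realType}.
Implicit Types (U V S W : set R[i]^o) (D z m v p q : R[i]) (c r a : R).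
Variables (h : R[i]^o -> R[i]^o) (e : R).
Hypothesis e0 : 0 < e.

Definition nbhd_measure (z : R[i]^o) : R[i]^o :=
  complex_measure (eps_nbhd e (dyn_orbit h z)).

Definition bounded_orbit z := exists M, forall n, cmod (iter n h z) <= M.

Lemma bounded_orbitS z : bounded_orbit z -> bounded_orbit (h z).
Proof. by move=> [M zM]; exists M => n; rewrite -iterSr. Qed.

Lemma eps_nbhdP z p : eps_nbhd e (dyn_orbit h z) p <->
  exists n, disc (iter n h z) e p.
Proof.
split=> [[_ [n _ <-]] /ball_cmod np|[n np]].
  by exists n; rewrite /disc /= cmodB.
by exists (iter n h z); [exists n|apply/ball_cmod; rewrite cmodB].
Qed.

Lemma bounded_measurable_eps_nbhd z : bounded_orbit z ->
  bounded_measurable (eps_nbhd e (dyn_orbit h z)).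
Proof.
move=> [M zM]; split.
  rewrite (_ : coords _ = \bigcup_n coords (disc (iter n h z) e)).
    by apply: bigcup_measurable => n _; exact: measurable_disc.
  apply/seteqP; split => x; first by move=> /eps_nbhdP[n xn]; exists n.
  by move=> [n _ xn]; apply/eps_nbhdP; exists n.
exists (e + M) => p /eps_nbhdP[n]; rewrite /disc /= => pn.
rewrite -[p](subrK (iter n h z)) (le_trans (cmodD _ _))//.
by rewrite lerD// ltW.
Qed.

Lemma nbhd_measure_diff z D : bounded_orbit z ->
  dot (nbhd_measure z - nbhd_measure (h z)) D =
  moment D (disc z e `\` eps_nbhd e (dyn_orbit h (h z))).
Proof.
move=> bz; rewrite dotDl dotNl -/(moment D _) -/(moment D _).
set S := eps_nbhd e (dyn_orbit h (h z)).
have bS : bounded_measurable S by exact/bounded_measurable_eps_nbhd/bounded_orbitS.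
have bE : bounded_measurable (disc z e `\` S).
  by apply: bounded_measurableD; [exact: bounded_measurable_disc|case: bS].
have -> : eps_nbhd e (dyn_orbit h z) = S `|` (disc z e `\` S).
  apply/seteqP; split => p.
    move=> /eps_nbhdP[[|n]] pn.
      by have [pS|pS] := pselect (S p); [left|right].
    by left; apply/eps_nbhdP; exists n; rewrite -iterSr.
  case=> [/eps_nbhdP[n pn]|[pz _]]; apply/eps_nbhdP.
    by exists n.+1; rewrite iterSr.
  by exists 0%N.
rewrite (moment_setU _ bS bE); first by rewrite addrC addKr.
by move=> p pS [].
Qed.

Lemma Re_div (w D : R[i]) : complex.Re (w / D) = dot w D / dot D D.
Proof.
case: w D => [x y] [b d]; rewrite /dot /= -!expr2; ring.
Qed.

(* Dividing by the first step z - h z normalizes the real part of the quotient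
   to half the area of a disc in the limit z -> 0 along the attracting
   direction. *)
Definition nbhd_quotient z : R[i] :=
  (nbhd_measure z - nbhd_measure (h z)) / (z - h z).

Variable z : R[i].
Hypotheses (bz : bounded_orbit z) (hz : h z != z)
  (hzz : dot (h z) (h z) <= dot z z).
Let D := z - h z.
Let S := eps_nbhd e (dyn_orbit h (h z)).
Let kappa := area (disc (0 : R[i]) e) / 2.

Let D0 : 0 < cmod D.
Proof. by rewrite cmod_gt0 subr_eq0 eq_sym. Qed.

Let DD : 0 < dot D D.
Proof. by rewrite -sqr_cmod exprn_gt0. Qed.

Let mS : measurable (coords S).
Proof. by case: (bounded_measurable_eps_nbhd (bounded_orbitS bz)). Qed.

Let z1S : disc (h z) e `<=` S.
Proof. by move=> p pz; apply/eps_nbhdP; exists 0%N. Qed.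

Lemma Re_nbhd_quotient : complex.Re (nbhd_quotient z) * dot (z - h z) (z - h z)
  = moment (z - h z) (disc z e `\` S).
Proof.
by rewrite /nbhd_quotient Re_div -nbhd_measure_diff// mulfVK// gt_eqF.
Qed.

Lemma nbhd_quotient_le :
  complex.Re (nbhd_quotient z) <=
  kappa + 2 * area (disc (0 : R[i]) 1) * e * cmod z.
Proof.
rewrite -(ler_pM2r DD) Re_nbhd_quotient.
have b0 : @bounded_measurable R set0.
  by split; [exact: measurable0|exists 0].
have sub0 : set0 `<=` (disc z e `\` disc (h z) e) `&` S by [].
have := @moment_exposed_le _ z (h z) e S e0 mS z1S hzz set0 0 b0 sub0.
by rewrite mul0r subr0; apply.
Qed.

(** In the cone z + W, the shell of thickness c1 |D| along the rim escapes the disc around h z, as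
    adding [D] to q lengthens it by at least that much, but it is covered by the disc around the
    iterate. Its area is at least c1 |D| e times that of the unit sector, and the integrand is at
    least c1 |D| e / 2: the product is a multiple of |D|^2. *)
Lemma nbhd_quotient_wedge_le W c1 c2 n :
  cone W -> measurable (coords W) -> 0 < c1 <= 1 -> 0 < c2 -> 2 * cmod D <= e ->
  (forall q, W q -> c1 * cmod D * cmod q <= dot q D) ->
  (forall q, W q -> dot q (z - iter n h (h z)) <= - c2 * cmod q) ->
  dot (z - iter n h (h z)) (z - iter n h (h z)) <= c2 * e ->
  complex.Re (nbhd_quotient z) <=
  kappa + 2 * area (disc (0 : R[i]) 1) * e * cmod z
  - c1 ^+ 2 * e ^+ 2 / 2 * area (disc_sector W 0 1).
Proof.
move=> cW mW /andP[c10 c11] c20 De WD Wn zn.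
set d := cmod D in De WD; set w := iter n h (h z) in Wn zn.
have cd : c1 * d <= d by rewrite ler_piMl// ltW.
have cd0 : 0 < c1 * d by rewrite mulr_gt0.
have s0 : 0 < e - c1 * d by lra.
have se : e - c1 * d <= e by lra.
have [bU aU] := area_annular_sector z cW mW s0 se.
set U := _ `\` _ in bU aU.
have Up p : U p -> [/\ W (p - z), cmod (p - z) < e & e - c1 * d <= cmod (p - z)].
  by move=> [[Wp pz] /negP]; rewrite -leNgt.
have US : U `<=` (disc z e `\` disc (h z) e) `&` S.
  move=> p /Up[Wp pz pz']; set q := p - z in Wp pz pz'.
  split; [split => //|].
    rewrite /disc /=; apply/negP; rewrite -leNgt.
    rewrite -(@ler_pXn2r _ 2) ?nnegrE ?cmod_ge0 ?(ltW e0)// sqr_cmod.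
    have -> : p - h z = q + D by rewrite /q /D; ring.
    have -> : dot (q + D) (q + D) = cmod q ^+ 2 + 2 * dot q D + d ^+ 2.
      by rewrite /d !sqr_cmod (dotDl q D) !(dotDr _ q D) (dotC D q); ring.
    have := WD _ Wp; have : (c1 * d) ^+ 2 <= d ^+ 2.
      by rewrite lerXn2r ?nnegrE// ltW.
    have : e ^+ 2 <= (cmod q + c1 * d) ^+ 2.
      by have q0 := cmod_ge0 q; rewrite lerXn2r ?nnegrE//; lra.
    move: (c1 * d) (cmod q) (dot q D) (d ^+ 2) => k x y d2; lra.
  (* On the shell |q| >= e / 2, so the cross term, at most -2 c2 |q|, outweighs |z - w|^2 <= c2
     e. *)
  apply/eps_nbhdP; exists n; rewrite /disc /= -/w cmod_lt//.
  have -> : p - w = q + (z - w) by rewrite /q; ring.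
  rewrite (dotDl q) !(dotDr _ q) (dotC (z - w) q).
  have := Wn _ Wp; have : dot q q < e ^+ 2 by rewrite -cmod_lt.
  nra.
have := moment_exposed_le e0 mS z1S hzz bU US (c := c1 * d * (e / 2)).
rewrite -/D -Re_nbhd_quotient aU => H.
rewrite -(ler_pM2r DD); apply: (le_trans (H _)).
  move=> p /Up[Wp pz pz'].
  have -> : dot p D = dot z D + dot (p - z) D by rewrite -dotDl; congr dot; ring.
  have zD : 0 <= dot z D.
    have := dot_ge0 D; move: hzz; rewrite /D; case: (z) (h z) => [x y] [b f].
    rewrite /dot /=; nra.
  rewrite -[c1 * d * _]add0r; apply: lerD => //.
  apply: le_trans (WD _ Wp); apply: ler_wpM2l; first exact: ltW.
  by apply: le_trans pz'; lra.
rewrite [leRHS]mulrBl lerD2l lerN2 -sqr_cmod -/d.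
set A := area (disc_sector W 0 1).
have A0 : 0 <= A by exact: area_ge0.
have -> : c1 ^+ 2 * e ^+ 2 / 2 * A * d ^+ 2 = c1 * d * (e / 2) * ((c1 * d * e) * A) by field.
apply: ler_wpM2l; first by rewrite mulr_ge0 ?ltW// divr_gt0.
by apply: ler_wpM2r => //; nra.
Qed.

End OrbitNeighborhoods.

(* D is the first step, E the sum of the following ones, in coordinates along v
   and i v; a point z + q outside the disc around z - D but inside the disc
   around z - D - E has q almost orthogonal to v. *)
Section Slab.
Context {R : realType}.

Lemma slab_bound (e d t Q Dv Di Ev Ei qv qi y : R) : 0 < e -> 0 < d -> 0 < t -> t <= 1 ->
  2 * d <= t * e -> `|Di| <= t * Dv -> `|Ei| <= t * Ev -> Dv <= d ->
  d ^+ 2 = Dv ^+ 2 + Di ^+ 2 ->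
  `|y| <= Q + d -> `|qi| <= Q -> e - d <= Q ->
  (qv + Dv) * Ev + y * Ei < 0 ->
  - (Dv ^+ 2 + Di ^+ 2) <= 2 * (qv * Dv + qi * Di) -> `|qv| <= 2 * t * Q.
Proof.
move=> e0 d0 t0 t1 De Dc Ec Dvd dE b1 b2 qd DqE qDd.
have te : t * e <= e by rewrite ler_piMl// ltW.
have dtQ : d <= t * Q by nra.
have Ev0 : 0 <= Ev by rewrite -(pmulr_rge0 _ t0) (le_trans _ Ec).
have Dv0 : 0 < Dv.
  have Dv0 : 0 <= Dv by rewrite -(pmulr_rge0 _ t0) (le_trans _ Dc).
  rewrite lt_neqAle Dv0 andbT; apply/eqP => D0; move: Dc dE.
  rewrite -D0 mulr0 normr_le0 => /eqP ->; rewrite expr0n /= addr0 => /eqP.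
  by rewrite expf_eq0 /= gt_eqF.
(* The upper bound on [qv] comes from the later steps: a larger qv + Dv would make the scalar
   product with E nonnegative. The lower bound comes from the first step alone. Both absorb d into t
   Q by [dtQ]. *)
rewrite ler_norml; apply/andP; split; last first.
  have : qv + Dv <= t * (Q + d).
    rewrite leNgt; apply/negP => H.
    have : - (y * Ei) <= (Q + d) * (t * Ev).
      by rewrite (le_trans (ler_norm _))// normrN normrM ler_pM.
    have := ler_wpM2r Ev0 (ltW H); lra.
  nra.
have qD : qi * Di <= Q * (t * Dv).
  by rewrite (le_trans (ler_norm _))// normrM ler_pM.
have D2 : Di ^+ 2 <= Dv ^+ 2.
  rewrite -[Di ^+ 2]real_normK ?num_real// lerXn2r ?nnegrE ?(ltW Dv0)//.
  by rewrite (le_trans Dc)// ler_piMl// ltW.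
have : 0 <= (qv + Dv + t * Q) * Dv by lra.
by rewrite pmulr_lge0//; lra.
Qed.

End Slab.

Section OrbitNeighborhoodsLower.
Context {R : realType}.
Implicit Types (U V S W : set R[i]^o) (D z m v p q : R[i]) (c r a : R).
Variables (h : R[i]^o -> R[i]^o) (e : R) (z : R[i]).
Hypotheses (e0 : 0 < e) (bz : bounded_orbit h z) (hz : h z != z)
  (hzz : dot (h z) (h z) <= dot z z).
Let D := z - h z.
Let S := eps_nbhd e (dyn_orbit h (h z)).
Let kappa := area (disc (0 : R[i]) e) / 2.

Let D0 : 0 < cmod D.
Proof. by rewrite cmod_gt0 subr_eq0 eq_sym. Qed.

Let DD : 0 < dot D D.
Proof. by rewrite -sqr_cmod exprn_gt0. Qed.

Let mS : measurable (coords S).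
Proof. by case: (bounded_measurable_eps_nbhd e (bounded_orbitS bz)). Qed.

Let z1S : disc (h z) e `<=` S.
Proof. by move=> p pz; apply/eps_nbhdP; exists 0%N. Qed.

(** When all sums of steps are nearly parallel to [v], the part of the crescent that later discs
    cover lies in directions almost orthogonal to [v], and in a shell of thickness |D|. Its area is
    at most 2 e |D| a and the integrand at most (|z| + e) |D|, so the loss is small relative to
    |D|^2 once [a] is small. *)
Lemma nbhd_quotient_ge v t a : cmod v = 1 -> 0 < t <= 1 ->
  2 * cmod D <= t * e ->
  area ([set q : R[i]^o | `|dot q v| <= 2 * t] `&` disc 0 1) <= a ->
  `|dot D ('i * v)| <= t * dot D v ->
  (forall n, let E := h z - iter n h (h z) in `|dot E ('i * v)| <= t * dot E v) ->
  kappa - 2 * e * (cmod z + e) * a <= complex.Re (nbhd_quotient h e z).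
Proof.
move=> v1 /andP[t0 t1]; set d := cmod D => De Sa Dc Ec.
pose W : set R[i]^o := [set q : R[i]^o | `|dot q v| <= 2 * t * cmod q].
have cW : cone W.
  move=> c q c0 Wq; change (`|dot (c%:C * q) v| <= 2 * t * cmod (c%:C * q)).
  rewrite cmodM cmodR (gtr0_norm c0) [leRHS]mulrCA.
  have -> : dot (c%:C * q) v = c * dot q v.
    by case: (q) (v) => [x y] [x' y']; rewrite /dot /=; ring.
  by rewrite normrM (gtr0_norm c0) ler_pM2l.
have mW : measurable (coords W).
  rewrite (_ : coords W = [set p : plane R |
      `|dot (p.1 +i* p.2 - 0) v| - 2 * t * cmod (p.1 +i* p.2 - 0) <= 0]).
    apply: measurable_le; apply: measurable_funB.
      by apply: measurableT_comp => //; exact: measurable_dot.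
    by apply: measurable_funM => //; exact: measurable_cmod.
  by apply/funext => p; rewrite /coords /W /= subr0 subr_le0.
have te : t * e <= e by rewrite ler_piMl// ltW.
have e0' := e0; have s0 : 0 < e - d by lra.
have d0 : 0 < d by [].
have se : e - d <= e by lra.
have [bU aU] := area_annular_sector z cW mW s0 se.
set U := _ `\` _ in bU aU.
have Aa : area (disc_sector W 0 1) <= a.
  apply: le_trans Sa; have [bA _] := area_disc_sector 0 cW mW ltr01.
  apply: area_le => //.
    rewrite setIC; apply: bounded_measurableI; first exact: bounded_measurable_disc.
    exact: measurable_strip.
  move=> q; rewrite disc_sector0 => -[Wq q1]; split; last by rewrite /disc /= subr0.
  apply: (le_trans Wq); rewrite ler_piMr//; [lra|exact: ltW].
have vi x y : dot x y = dot x v * dot y v + dot x ('i * v) * dot y ('i * v).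
  have vv : dot v v = 1 by rewrite -sqr_cmod v1 expr1n.
  rewrite -[LHS]mulr1 -vv; case: (x) (y) (v) => [x1 x2] [y1 y2] [v1' v2'].
  by rewrite /dot /=; ring.
have iv1 : cmod ('i * v) = 1.
  by rewrite cmodM v1 mulr1 /cmod /= expr0n expr1n add0r sqrtr1.
have SU : (disc z e `\` disc (h z) e) `&` S `<=` U.
  move=> p [[pz pz1] /eps_nbhdP[n pn]]; set q := p - z.
  have qe : cmod q < e by [].
  have qDe : e <= cmod (q + D).
    rewrite (_ : q + D = p - h z); last by rewrite /q /D; ring.
    by rewrite leNgt; apply/negP.
  have := Ec n; set E := h z - iter n h (h z) => /= {}Ec.
  have qDEe : cmod (q + D + E) < e.
    by rewrite (_ : q + D + E = p - iter n h (h z))//; rewrite /q /D /E; ring.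
  have qD : e - d <= cmod q by have := cmodD q D; rewrite -/d; lra.
  split; last by rewrite /disc /=; apply/negP; rewrite -leNgt.
  split => //; rewrite /W /=.
  (* The vector q + D has length at least e and adding [E] makes it shorter than e. *)
  have DqE : dot (q + D) E < 0.
    have : dot (q + D + E) (q + D + E) < dot (q + D) (q + D).
      by rewrite -!sqr_cmod ltrXn2r ?nnegrE ?cmod_ge0//; exact: lt_le_trans qDe.
    have := dot_ge0 E.
    case: (q + D) (E) => [x1 x2] [y1 y2]; rewrite /dot /=; lra.
  have qDd : - d ^+ 2 <= 2 * dot q D.
    have : dot q q <= dot (q + D) (q + D).
      rewrite -!sqr_cmod lerXn2r ?nnegrE ?cmod_ge0//.
      exact: le_trans (ltW qe) qDe.
    rewrite /d sqr_cmod.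
    case: (q) (D) => [x1 x2] [y1 y2]; rewrite /dot /=; lra.
  move: DqE qDd; rewrite (vi (q + D)) (vi q D).
  have dE : d ^+ 2 = dot D v ^+ 2 + dot D ('i * v) ^+ 2.
    by rewrite /d sqr_cmod vi !expr2.
  rewrite [in X in _ -> X -> _]dE !(dotDl q D v).
  have Dv : dot D v <= d.
    rewrite (le_trans (ler_norm _))// (le_trans (cauchy_schwarz _ _))//.
    by rewrite v1 mulr1.
  have b1 : `|dot (q + D) ('i * v)| <= cmod q + d.
    rewrite (le_trans (cauchy_schwarz _ _))// iv1 mulr1; exact: cmodD.
  have b2 : `|dot q ('i * v)| <= cmod q.
    by rewrite (le_trans (cauchy_schwarz _ _))// iv1 mulr1.
  exact: (slab_bound e0' d0 t0 t1 De Dc Ec Dv dE b1 b2 qD).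
have := @moment_exposed_ge _ z (h z) e S e0 mS z1S hzz U bU SU.
rewrite -/D -(Re_nbhd_quotient e bz hz) aU -/d -/kappa => H.
rewrite -(ler_pM2r DD); apply: (le_trans _ H).
rewrite [leLHS]mulrBl lerD2l lerN2 -sqr_cmod -/d.
set A := area (disc_sector W 0 1) in Aa *.
have ze : 0 <= cmod z + e by rewrite addr_ge0 ?cmod_ge0// ltW.
have -> : 2 * e * (cmod z + e) * a * d ^+ 2 = (cmod z + e) * d * (2 * e * d * a) by ring.
apply: ler_wpM2l; first by rewrite mulr_ge0// ltW.
have A0 : 0 <= A by exact: area_ge0.
apply: ler_pM => //; [nra|].
have := sqr_ge0 d; nra.
Qed.

End OrbitNeighborhoodsLower.

(** * Dynamics near the attracting direction *)

Section Dynamics.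
Context {R : realType}.

(** The error on the imaginary part is relative to |s| because it will be compared with cones of
    arbitrarily small opening. *)
Lemma pow_expand (k : nat) (eta : R) : 0 < eta -> exists2 t : R, 0 < t <= 1 &
  forall s, `|s| <= t -> exists X Y, [/\ (1 +i* s) ^+ k = X +i* Y,
    `|X - 1| <= eta & `|Y - k%:R * s| <= eta * `|s|].
Proof.
elim: k eta => [|k IH] eta eta0.
  exists 1; first by rewrite ltr01 lexx.
  move=> s _; exists 1, 0; split => //; first by rewrite subrr normr0 ltW.
  by rewrite mul0r subrr normr0 mulr_ge0// ltW.
pose eta' := Num.min (eta / 2) 1.
have eta'0 : 0 < eta' by rewrite lt_min ltr01 divr_gt0.
have [t /andP[t0 t1] H] := IH eta' eta'0.
have k1 : 0 < k%:R + 1 :> R by rewrite ltr_wpDl.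
exists (Num.min t (eta / 2 / (k%:R + 1))).
  by rewrite lt_min t0 !divr_gt0//= ge_min t1.
move=> s; rewrite le_min => /andP[st se].
have [X [Y [E X1 Y1]]] := H s st.
have e2 : eta' <= eta / 2 by rewrite ge_min lexx.
have e1 : eta' <= 1 by rewrite ge_min lexx orbT.
have s0 : 0 <= `|s| by [].
exists (X - s * Y), (Y + s * X); split.
- rewrite exprS E; apply/eqP; rewrite eq_complex /=.
  by apply/andP; split; apply/eqP; ring.
- have Yb : `|Y| <= (k%:R + 1) * `|s|.
    rewrite -[Y](subrK (k%:R * s)) (le_trans (ler_normD _ _))//.
    rewrite normrM ger0_norm//; nra.
  have sY : `|s| * `|Y| <= eta / 2.
    apply: (@le_trans _ _ (`|s| * ((k%:R + 1) * `|s|))); first exact: ler_wpM2l.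
    apply: (@le_trans _ _ (1 * ((k%:R + 1) * `|s|))).
      by apply: ler_wpM2r; [rewrite mulr_ge0// ltW|exact: le_trans t1].
    by rewrite mul1r mulrC -ler_pdivlMr.
  rewrite addrAC (le_trans (ler_normD _ _))// normrN normrM; lra.
- have -> : Y + s * X - k.+1%:R * s = (Y - k%:R * s) + s * (X - 1).
    by rewrite -natr1; ring.
  rewrite (le_trans (ler_normD _ _))// normrM; nra.
Qed.

Variables (k : nat) (a v : R[i]) (b : R) (h : R[i]^o -> R[i]^o) (V : set R[i]^o).
Hypotheses (k0 : (0 < k)%N) (b0 : 0 < b) (v1 : cmod v = 1)
  (av : a * v ^+ k = - b%:C)
  (hV : forall eps : R, 0 < eps -> exists2 r : R, 0 < r & forall z, V z ->
     cmod z < r -> cmod (h z - z - a * z ^+ k.+1) <= eps * cmod z ^+ k.+1)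
  (secV : exists t r : R, [/\ 0 < t, 0 < r & forall x s, 0 < x < r -> `|s| <= t ->
     V (v * (x%:C * (1 +i* s)))]).

(* Polar-like coordinates of slope s, in which the attracting direction v is
   the positive real axis. *)
Definition ray_point (x s : R) : R[i] := v * (x%:C * (1 +i* s)).

Lemma cmod_ray_point x s : 0 < x -> `|s| <= 1 -> x <= cmod (ray_point x s) <= 2 * x.
Proof.
move=> x0 s1; rewrite /ray_point !cmodM v1 mul1r cmodR gtr0_norm// [2 * x]mulrC.
rewrite -{1}[x]mulr1 !ler_pM2l//; apply/andP; split.
  by have := Re_le_cmod (1 +i* s); rewrite /= normr1.
by rewrite (le_trans (cmod_le_ReIm _))//= normr1 lerD2l.
Qed.

(** In the frame of [v] the leading term of z - h z is b x^(k+1) (1 + i s)^(k+1), of slope about (k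
    + 1) s. The range [t] of slopes depends on [eta] alone; the remainder of [h] is absorbed in
    [eps] afterwards, by shrinking [r]. *)
Lemma step_estimate (eta : R) : 0 < eta -> exists2 t : R, 0 < t <= 1 &
  forall eps : R, 0 < eps -> exists2 r : R, 0 < r &
  forall x s, 0 < x < r -> `|s| <= t -> V (ray_point x s) /\
  exists X Y, [/\ ray_point x s - h (ray_point x s) =
      v * ((b * x ^+ k.+1)%:C * (X +i* Y)),
    `|X - 1| <= eta & `|Y - k.+1%:R * s| <= eta * `|s| + eps].
Proof.
move=> eta0; have [t' [r' [t'0 r'0 sV]]] := secV.
have eta20 : 0 < eta / 2 by rewrite divr_gt0.
have [t /andP[t0 t1] Hp] := pow_expand k.+1 eta20.
exists (Num.min t t'); first by rewrite lt_min t0 t'0 ge_min t1.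
move=> eps eps0.
pose e1 := Num.min eps (eta / 2).
have e10 : 0 < e1 by rewrite lt_min eps0.
(* The power of 2 pays for |z| <= 2 x, and [b] for the normalization of the step. *)
pose e2 := e1 * b / 2 ^+ k.+1.
have e20 : 0 < e2 by rewrite divr_gt0 ?exprn_gt0// mulr_gt0.
have [r r0 Hr] := hV e20.
exists (Num.min r' (r / 2)); first by rewrite lt_min r'0 divr_gt0.
move=> x s; rewrite lt_min => /andP[x0 /andP[xr' xr]].
rewrite le_min => /andP[st st'].
have s1 : `|s| <= 1 by exact: le_trans t1.
have Vz : V (ray_point x s) by apply: sV => //; rewrite x0.
split => //.
set z := ray_point x s in Vz *.
have [X [Y [E X1 Y1]]] := Hp s st.
have /andP[zx zx2] := cmod_ray_point x0 s1; rewrite -/z in zx zx2.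
have zr : cmod z < r by rewrite (le_lt_trans zx2)//; lra.
pose w := h z - z - a * z ^+ k.+1.
have wle : cmod w <= e2 * cmod z ^+ k.+1 by exact: Hr.
have bx : 0 < b * x ^+ k.+1 by rewrite mulr_gt0// exprn_gt0.
have v0 : v != 0 by rewrite -cmod_gt0 v1 ltr01.
have bxC : (b * x ^+ k.+1)%:C != 0 by rewrite (inj_eq (@complexI _)) gt_eqF.
pose u := w / (v * (b * x ^+ k.+1)%:C).
have ue : cmod u <= e1.
  rewrite /u cmodM cmodV cmodM v1 mul1r cmodR gtr0_norm// ler_pdivrMr//.
  rewrite (le_trans wle)// /e2.
  have : cmod z ^+ k.+1 <= (2 * x) ^+ k.+1.
    by rewrite lerXn2r// nnegrE ?cmod_ge0// (le_trans _ zx2)// cmod_ge0.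
  rewrite exprMn => zz.
  have -> : e1 * (b * x ^+ k.+1) = e1 * b / 2 ^+ k.+1 * (2 ^+ k.+1 * x ^+ k.+1).
    have P0 : 2 ^+ k.+1 != 0 :> R by rewrite expf_neq0// pnatr_eq0.
    by move: (2 ^+ k.+1) P0 => P P0; field.
  by apply: ler_wpM2l => //; exact: ltW.
have e1e : e1 <= eps by rewrite ge_min lexx.
have e1h : e1 <= eta / 2 by rewrite ge_min lexx orbT.
exists (X - complex.Re u), (Y - complex.Im u); split.
- have -> : (X - complex.Re u) +i* (Y - complex.Im u) = (1 +i* s) ^+ k.+1 - u.
    by rewrite E; case: (u) => u1 u2; simpc.
  have -> : z - h z = - (a * z ^+ k.+1) - w by rewrite /w; ring.
  have -> : w = v * ((b * x ^+ k.+1)%:C * u) by rewrite /u mulrA [RHS]mulrC mulfVK// mulf_neq0.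
  have -> : a * z ^+ k.+1 = - (v * ((b * x ^+ k.+1)%:C * (1 +i* s) ^+ k.+1)).
    have avS : a * v ^+ k.+1 = - (b%:C * v) by rewrite exprSr mulrA av mulNr.
    have -> : z ^+ k.+1 = v ^+ k.+1 * (x%:C ^+ k.+1 * (1 +i* s) ^+ k.+1).
      by rewrite /z /ray_point !exprMn.
    rewrite (mulrA a) avS rmorphM rmorphXn.
    by move: (x%:C ^+ _) ((1 +i* s) ^+ _) => y y'; ring.
  by ring.
- rewrite addrAC (le_trans (ler_normD _ _))// normrN.
  by have := Re_le_cmod u; lra.
- rewrite addrAC (le_trans (ler_normD _ _))// normrN.
  have := Im_le_cmod u; have := normr_ge0 s; nra.
Qed.

Lemma dot_unit_left (w : R[i]) : dot (v * w) v = complex.Re w.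
Proof.
have vv : dot v v = 1 by rewrite -sqr_cmod v1 expr1n.
rewrite -[RHS]mulr1 -vv.
by case: (v) w => [v2 v3] [w1 w2]; rewrite /dot /=; ring.
Qed.

Lemma dot_unit_left_i (w : R[i]) : dot (v * w) ('i * v) = complex.Im w.
Proof.
have vv : dot v v = 1 by rewrite -sqr_cmod v1 expr1n.
rewrite -[RHS]mulr1 -vv.
by case: (v) w => [v2 v3] [w1 w2]; rewrite /dot /=; ring.
Qed.

(** Fixes the numerical margins for the later linear arithmetic: 1/20 on the step, slopes at most 1
    / (2 (k + 2)), and a step short compared with x. The absolute error [eps] on the slope stays
    free, to be taken small relative to a given cone. *)
Lemma small_step : exists2 t : R, 0 < t /\ k.+2%:R * t <= 1 / 2 &
  forall eps : R, 0 < eps -> exists2 r : R, 0 < r <= 1 &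
  forall x s, 0 < x < r -> `|s| <= t ->
  [/\ V (ray_point x s), b * x ^+ k * k.+2%:R <= 1 / 4 & exists X Y,
    [/\ ray_point x s - h (ray_point x s) =
      v * ((b * x ^+ k.+1)%:C * (X +i* Y)),
    `|X - 1| <= 1 / 20 & `|Y - k.+1%:R * s| <= 1 / 20 * `|s| + eps]].
Proof.
have e20 : 0 < 1 / 20 :> R by rewrite divr_gt0.
have [t /andP[t0 t1] H] := step_estimate e20.
have k2 : 0 < k.+2%:R :> R by [].
exists (Num.min t (1 / 2 / k.+2%:R)).
  split; first by rewrite lt_min t0 !divr_gt0.
  by rewrite mulrC -ler_pdivlMr// ge_min lexx orbT.
move=> eps /H[r r0 {}H].
have bk : 0 < 1 / 4 / (b * k.+2%:R) by rewrite !divr_gt0// mulr_gt0.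
exists (Num.min (Num.min r 1) (1 / 4 / (b * k.+2%:R))).
  by rewrite !lt_min r0 ltr01 bk ge_min ge_min lexx orbT.
move=> x s; rewrite !lt_min => /andP[x0 /andP[/andP[xr x1] xb]].
rewrite le_min => /andP[st _].
have [|Vz HXY] := H x s _ st; first by rewrite x0.
split => //.
have xk : x ^+ k <= x.
  rewrite -(prednK k0) exprS ler_piMr ?(ltW x0)//.
  by rewrite exprn_ile1 ?(ltW x0) ?(ltW x1).
move: xb; rewrite ltr_pdivlMr ?mulr_gt0// => xb.
have : b * x ^+ k * k.+2%:R <= x * (b * k.+2%:R).
  rewrite [b * _]mulrC -mulrA; apply: ler_wpM2r => //.
  by rewrite ltW// mulr_gt0.
lra.
Qed.

Lemma ray_pointE x s X Y :
  ray_point x s - h (ray_point x s) = v * ((b * x ^+ k.+1)%:C * (X +i* Y)) ->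
  h (ray_point x s) =
    v * (x * (1 - b * x ^+ k * X) +i* (x * (s - b * x ^+ k * Y))).
Proof.
move=> E; rewrite -[LHS](subKr (ray_point x s)) E /ray_point -mulrBr.
congr (_ * _); apply/eqP; rewrite eq_complex /= exprS.
by apply/andP; split; apply/eqP; ring.
Qed.

Lemma step_shrinks : exists2 t : R, 0 < t &
  exists2 r : R, 0 < r & forall x s, 0 < x < r -> `|s| <= t ->
  [/\ `|s| <= 1, V (ray_point x s), h (ray_point x s) != ray_point x s &
   dot (h (ray_point x s)) (h (ray_point x s)) <=
   dot (ray_point x s) (ray_point x s)].
Proof.
have [t [t0 t1] /(_ (1 / 4))[|r /andP[r0 _] H]] := small_step.
  by rewrite divr_gt0.
exists t => //; exists r => // x s xr st.
have [Vz bx [X [Y [E X1 Y1]]]] := H x s xr st.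
have x0 : 0 < x by case/andP: xr.
have s0 := normr_ge0 s.
have k2 : 2 <= k.+2%:R :> R by rewrite ler_nat.
have s1 : `|s| <= 1 / 4 by nra.
have kE : k.+2%:R = k.+1%:R + 1 :> R by rewrite natr1.
have Yb : `|Y| <= 1.
  have : `|k.+1%:R * s| <= 1 / 2 by rewrite normrM ger0_norm//; nra.
  have := ler_normD (Y - k.+1%:R * s) (k.+1%:R * s); rewrite subrK; lra.
have bxk : 0 < b * x ^+ k by rewrite mulr_gt0// exprn_gt0.
have Xb : 19 / 20 <= X <= 21 / 20 by move: X1; rewrite ler_norml => /andP[]; lra.
split => //; first by lra.
  rewrite eq_sym -subr_eq0 E !mulf_neq0//.
  - by rewrite -cmod_gt0 v1 ltr01.
  - by rewrite (inj_eq (@complexI _)) gt_eqF// mulr_gt0// exprn_gt0.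
  - rewrite eq_complex /= negb_and gt_eqF//; lra.
rewrite (ray_pointE E) /ray_point !dotMM; apply: ler_wpM2l; first exact: dot_ge0.
rewrite /dot /=; set m := b * x ^+ k in bx bxk *.
have m1 : m <= 1 / 8 by nra.
rewrite [leRHS](_ : _ = x ^+ 2 * (1 + s ^+ 2)); last by ring.
rewrite [leLHS](_ : _ = x ^+ 2 * (1 + s ^+ 2 -
  m * (2 * (X + s * Y) - m * (X ^+ 2 + Y ^+ 2)))); last by ring.
apply: ler_wpM2l; first exact: sqr_ge0.
rewrite gerBl; apply: mulr_ge0; first exact: ltW.
have sY : - (1 / 4) <= s * Y.
  have : `|s * Y| <= 1 / 4 by rewrite normrM; nra.
  by rewrite ler_norml => /andP[].
have XY : X ^+ 2 + Y ^+ 2 <= 3.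
  have : Y ^+ 2 <= 1 by rewrite -(real_normK (num_real Y)) exprn_ile1.
  have : X ^+ 2 <= 2 by nra.
  lra.
have : 0 <= X ^+ 2 + Y ^+ 2 by rewrite addr_ge0// sqr_ge0.
nra.
Qed.

(** With m = b x^k the slope becomes (s - m Y) / (1 - m X), roughly s (1 - (k + 1) m) / (1 - m).
    Since k + 1 >= 2 it contracts, by enough to absorb the remainder u / 2. The steps themselves are
    steeper than the positions, hence the wider cone for [D]. *)
Lemma cone_invariant : exists2 t : R, 0 < t & forall u, 0 < u <= t ->
  exists2 r : R, 0 < r & forall x s, 0 < x < r -> `|s| <= u ->
  let D := ray_point x s - h (ray_point x s) in
  `|dot D ('i * v)| <= 2 * k.+2%:R * u * dot D v /\
  exists x1 s1, [/\ h (ray_point x s) = ray_point x1 s1, 0 < x1 <= x & `|s1| <= u].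
Proof.
have [t [t0 t1] H] := small_step; exists t => // u /andP[u0 ut].
have [|r /andP[r0 _] {}H] := H (u / 2); first by rewrite divr_gt0.
exists r => // x s xr su /=.
have [Vz bx [X [Y [E X1 Y1]]]] := H x s xr (le_trans su ut).
have x0 : 0 < x by case/andP: xr.
have s0 := normr_ge0 s.
have kE : k.+2%:R = k.+1%:R + 1 :> R by rewrite natr1.
have k1 : 2 <= k.+1%:R :> R by rewrite ler_nat ltnS.
have bxk : 0 < b * x ^+ k by rewrite mulr_gt0// exprn_gt0.
have bxk1 : 0 < b * x ^+ k.+1 by rewrite mulr_gt0// exprn_gt0.
have [Xb Xb'] : 19 / 20 <= X /\ X <= 21 / 20.
  by move: X1; rewrite ler_norml => /andP[]; lra.
have Yb : `|Y| <= k.+2%:R * u.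
  have : `|k.+1%:R * s| <= k.+1%:R * u by rewrite normrM ger0_norm// ler_wpM2l.
  by have := ler_normD (Y - k.+1%:R * s) (k.+1%:R * s); rewrite subrK kE; lra.
split.
  rewrite E dot_unit_left dot_unit_left_i /= !mul0r subr0 addr0.
  rewrite normrM (gtr0_norm bxk1) mulrCA; apply: ler_wpM2l; first exact: ltW.
  have K0 : 0 <= k.+2%:R * u by rewrite mulr_ge0// ltW.
  have := ler_wpM2l K0 Xb; lra.
set m := b * x ^+ k in bx bxk.
have mk : m * k.+1%:R <= 1 / 4 by nra.
have mX : 1 / 2 <= 1 - m * X by nra.
exists (x * (1 - m * X)), ((s - m * Y) / (1 - m * X)).
have mX0 : 0 < 1 - m * X by lra.
split.
- rewrite (ray_pointE E) /ray_point -/m; congr (_ * _); apply/eqP.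
  rewrite eq_complex /= !mul0r subr0 addr0 mulr1 eqxx /=.
  by apply/eqP; field; rewrite gt_eqF.
- by rewrite mulr_gt0//= ler_piMr ?(ltW x0)//; nra.
rewrite normrM [`|_^-1|]gtr0_norm ?invr_gt0// ler_pdivrMr//.
have -> : s - m * Y = s * (1 - m * k.+1%:R) - m * (Y - k.+1%:R * s) by ring.
rewrite (le_trans (ler_normB _ _))// (normrM s) (normrM m) (gtr0_norm bxk).
rewrite [`|1 - _|]ger0_norm; last by lra.
have : m * `|Y - k.+1%:R * s| <= m * (1 / 20 * u + u / 2).
  by apply: ler_wpM2l; [exact: ltW|lra].
have : `|s| * (1 - m * k.+1%:R) <= u * (1 - m * k.+1%:R) by apply: ler_wpM2r => //; lra.
have mu : 0 < m * u by exact: mulr_gt0.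
have : m * u * X <= m * u * (21 / 20) by apply: ler_wpM2l => //; exact: ltW.
have : m * u * 2 <= m * u * k.+1%:R by apply: ler_wpM2l => //; exact: ltW.
lra.
Qed.

End Dynamics.

(** * Limit of the quotient along the attracting direction *)

Section Asymptotics.
Context {R : realType}.
Variables (k : nat) (a v : R[i]) (b : R) (h : R[i]^o -> R[i]^o) (V : set R[i]^o).
Hypotheses (k0 : (0 < k)%N) (b0 : 0 < b) (v1 : cmod v = 1)
  (av : a * v ^+ k = - b%:C)
  (hV : forall eps : R, 0 < eps -> exists2 r : R, 0 < r & forall z, V z ->
     cmod z < r -> cmod (h z - z - a * z ^+ k.+1) <= eps * cmod z ^+ k.+1)
  (secV : exists t r : R, [/\ 0 < t, 0 < r & forall x s, 0 < x < r -> `|s| <= t ->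
     V (v * (x%:C * (1 +i* s)))])
  (orbV : forall z, V z -> (fun n => iter n h z) @ \oo --> (0 : R[i]^o)).
Variable e : R.
Hypothesis e0 : 0 < e.

Let Q := nbhd_quotient h e.
Let kappa := area (disc (0 : R[i]) e) / 2.

Lemma orbit_small z : V z -> forall eps : R, 0 < eps ->
  exists n0, forall n, (n0 <= n)%N -> cmod (iter n h z) <= eps.
Proof.
move=> Vz eps eps0; have /cvgrPdist_le/(_ eps%:C) := orbV Vz.
rewrite ltcR => /(_ eps0)[n0 _ H]; exists n0 => n /H.
by rewrite sub0r normrN normE lecR.
Qed.

Lemma orbit_bounded z : V z -> bounded_orbit h z.
Proof.
move=> Vz; have [n0 H] := orbit_small Vz ltr01.
exists (1 + \sum_(i < n0) cmod (iter i h z)) => n.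
have [nn0|n0n] := ltnP n n0; last first.
  rewrite (le_trans (H n n0n))// lerDl sumr_ge0// => i _; exact: cmod_ge0.
rewrite (bigD1 (Ordinal nn0))//= addrCA lerDl addr_ge0// sumr_ge0// => i _.
exact: cmod_ge0.
Qed.

Lemma upper_estimate : exists2 t : R, 0 < t & forall eps : R, 0 < eps ->
  exists2 r : R, 0 < r & forall x s, 0 < x < r -> `|s| <= t ->
  complex.Re (Q (ray_point v x s)) <= kappa + eps.
Proof.
have [t t0 [r r0 H]] := step_shrinks k0 b0 v1 av hV secV.
exists t => // eps eps0.
pose c := 2 * area (disc (0 : R[i]) 1) * e.
have c0 : 0 < c by rewrite !mulr_gt0// area_disc1_gt0.
exists (Num.min r (eps / (2 * c))).
  by rewrite lt_min r0 divr_gt0// mulr_gt0.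
have c20 : 0 < 2 * c by rewrite mulr_gt0.
move=> x s /andP[x0]; rewrite lt_min ltr_pdivlMr// => /andP[xr xe] st.
have [|s1 Vz hz hzz] := H x s _ st; first by rewrite x0.
apply: (le_trans (nbhd_quotient_le e0 (orbit_bounded Vz) hz hzz)).
rewrite lerD2l -/c; have /andP[_ zx] := cmod_ray_point v1 x0 s1.
have := ler_wpM2l (ltW c0) zx; lra.
Qed.

(** A point of slope 0 lies in every cone, so for small x its whole orbit stays in a cone of
    prescribed opening u, and its steps in one of opening T. This is the precise sense in which the
    orbit is straight. *)
Lemma lower_estimate (eps : R) : 0 < eps ->
  exists2 r : R, 0 < r & forall x, 0 < x < r ->
  kappa - eps <= complex.Re (Q (ray_point v x 0)).
Proof.
move=> eps0; have [t t0 [r r0 H]] := step_shrinks k0 b0 v1 av hV secV.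
have [t' t'0 H'] := cone_invariant k0 b0 v1 av hV secV.
(* The loss 2 e (|z| + e) A of [nbhd_quotient_ge] is then at most [eps], since x < 1 / 2 gives |z|
   <= 1. *)
pose A := eps / (2 * e * (1 + e)).
have A0 : 0 < A by rewrite divr_gt0// !mulr_gt0// addr_gt0.
have [s s0 sA] := area_strip_small v1 A0.
pose T := Num.min (s / 2) 1.
have T0 : 0 < T by rewrite lt_min ltr01 divr_gt0.
have T1 : T <= 1 by rewrite ge_min lexx orbT.
have Ts : 2 * T <= s.
  by have : T <= s / 2; [rewrite ge_min lexx|lra].
have k2 : 0 < 2 * k.+2%:R :> R by rewrite mulr_gt0.
pose u := Num.min t' (T / (2 * k.+2%:R)).
have u0 : 0 < u by rewrite lt_min t'0 divr_gt0.
have ut : u <= t' by rewrite ge_min lexx.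
have uT : 2 * k.+2%:R * u <= T by rewrite mulrC -ler_pdivlMr// ge_min lexx orbT.
have [|r' r'0 {}H'] := H' u; first by rewrite u0.
exists (Num.min (Num.min r r') (Num.min (1 / 2) (T * e / 8))).
  by rewrite !lt_min r0 r'0 !divr_gt0// mulr_gt0.
move=> x /andP[x0]; rewrite !lt_min => /andP[/andP[xr xr'] /andP[x2 xT]].
have [||s1 Vz hz hzz] := H x 0; [by rewrite x0|by rewrite normr0 ltW|].
have /andP[_ zx] := cmod_ray_point v1 x0 s1.
set z := ray_point v x 0 in Vz hz hzz zx *.
have cone_le D : `|dot D ('i * v)| <= 2 * k.+2%:R * u * dot D v ->
    `|dot D ('i * v)| <= T * dot D v.
  move=> DD; apply: (le_trans DD); apply: ler_wpM2r => //.
  by rewrite -(pmulr_rge0 _ (mulr_gt0 k2 u0)) (le_trans _ DD).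
have hzle : cmod (h z) <= cmod z by rewrite cmod_le ?cmod_ge0// sqr_cmod.
have Dle : cmod (z - h z) <= 4 * x.
  by have := cmodD z (- h z); rewrite cmodN; lra.
have [] := H' x 0; [by rewrite x0|by rewrite normr0 ltW|].
rewrite -/z => /cone_le Dz [x1 [s1' [hzE /andP[x10 x1x] s1u]]].
(* The cone of opening T is convex, so it contains the sums of steps as well as the steps. *)
have orb n : exists x s, [/\ iter n h (h z) = ray_point v x s, 0 < x < r', `|s| <= u &
    `|dot (h z - iter n h (h z)) ('i * v)| <= T * dot (h z - iter n h (h z)) v].
  elim: n => [|n [xn [sn [E xnr snu IH]]]].
    exists x1, s1'; split => //; first by rewrite x10 (le_lt_trans x1x).
    by rewrite /= subrr /dot !mul0r addr0 normr0 mulr0.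
  have [] := H' xn sn xnr snu.
  rewrite -E => /cone_le Dn [x' [s' [E' /andP[x'0 x'x] s'u]]].
  have xn_r : xn < r' by case/andP: xnr.
  exists x', s'; split => //; first by rewrite x'0 (le_lt_trans x'x).
  have -> : h z - iter n.+1 h (h z) = (h z - iter n h (h z))
      + (iter n h (h z) - h (iter n h (h z))) by rewrite iterS; ring.
  rewrite !(dotDl (h z - iter n h (h z))) mulrDr.
  by rewrite (le_trans (ler_normD _ _))// lerD.
have strip_le : area ([set q : R[i]^o | `|dot q v| <= 2 * T] `&` disc 0 1) <= A.
  apply: le_trans sA; apply: area_le.
  - rewrite setIC; apply: bounded_measurableI; first exact: bounded_measurable_disc.
    exact: measurable_strip.
  - rewrite setIC; apply: bounded_measurableI; first exact: bounded_measurable_disc.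
    exact: measurable_strip.
  - by move=> q [/= qT q1]; split => //=; exact: le_trans Ts.
have := @nbhd_quotient_ge _ h e z e0 (orbit_bounded Vz) hz hzz v T A v1.
rewrite T0 T1 => /(_ isT) H1; apply: le_trans (H1 _ _ _ _).
- rewrite lerD2l lerN2 /A.
  apply: (@le_trans _ _ (2 * e * (1 + e) * (eps / (2 * e * (1 + e))))).
    apply: ler_wpM2r; first exact: ltW.
    by apply: ler_wpM2l; [rewrite mulr_ge0// ltW|lra].
  by rewrite mulrC mulfVK// gt_eqF// !mulr_gt0// addr_gt0.
- lra.
- exact: strip_le.
- exact: Dz.
- by move=> n; have [? [? [_ _ _]]] := orb n.
Qed.

End Asymptotics.

(** * The loss of mass away from the attracting direction *)

Section WedgeSets.
Context {R : realType}.
Implicit Types (q D v : R[i]) (sg s : R).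

Lemma dot_decomp q v (w : R[i]) : dot q (v * w) =
  dot q v * complex.Re w + dot q ('i * v) * complex.Im w.
Proof. by case: q v w => [q1 q2] [v2 v3] [w1 w2]; rewrite /dot /=; ring. Qed.

Lemma cmod_le_dots q v : cmod v = 1 -> cmod q <= `|dot q v| + `|dot q ('i * v)|.
Proof.
move=> v1; have vv : dot v v = 1 by rewrite -sqr_cmod v1 expr1n.
rewrite cmod_le ?addr_ge0// sqrrD !real_normK ?num_real//.
have -> : dot q q = dot q v ^+ 2 + dot q ('i * v) ^+ 2.
  rewrite -[LHS]mulr1 -vv; case: q (v) => [q1 q2] [v2 v3]; rewrite /dot /=; ring.
rewrite addrAC lerDl; apply: mulrn_wge0; exact: mulr_ge0.
Qed.

(* The directions v (- t + i sg) with 1.3 s <= t <= 1.5 s: for a point of slope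
   sg s, they make an obtuse angle with the point, of slope about sg s, and an
   acute one with the first step, of slope about (k + 1) sg s. *)
Definition wedge v sg s : set R[i]^o := [set q : R[i]^o |
  13 / 10 * s * (sg * dot q ('i * v)) <= - dot q v <= 15 / 10 * s * (sg * dot q ('i * v))].

Lemma cone_wedge v sg s : cone (wedge v sg s).
Proof.
move=> c q c0; rewrite /wedge /=.
have dc w : dot (c%:C * q) w = c * dot q w.
  by case: (q) w => [x y] [x' y']; rewrite /dot /=; ring.
rewrite !dc => /andP[h1 h2]; apply/andP; split.
- have := ler_wpM2l (ltW c0) h1; lra.
- have := ler_wpM2l (ltW c0) h2; lra.
Qed.

Lemma measurable_wedge v sg s : measurable (coords (wedge v sg s)).
Proof.
pose D1 : R[i] := v * (1 +i* (13 / 10 * s * sg)).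
pose D2 : R[i] := v * ((-1) +i* (- (15 / 10 * s * sg))).
have md D : measurable_fun setT (fun p : plane R => dot (p.1 +i* p.2) D).
  rewrite (_ : (fun _ => _) = (fun p : plane R => dot (p.1 +i* p.2 - 0) D)).
    exact: measurable_dot.
  by apply/funext => p; rewrite subr0.
have wedgeE q : wedge v sg s q <-> dot q D1 <= 0 /\ dot q D2 <= 0.
  rewrite /wedge /D1 /D2 (dot_decomp q v (1 +i* _)) (dot_decomp q v ((-1) +i* _)) /=.
  move: (dot q v) (dot q _) => x y; split.
    by move=> /andP[h1 h2]; split; lra.
  by move=> [h1 h2]; apply/andP; split; lra.
rewrite (_ : coords _ = [set p : plane R | dot (p.1 +i* p.2) D1 <= 0] `&`
   [set p : plane R | dot (p.1 +i* p.2) D2 <= 0]).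
  by apply: measurableI; apply: measurable_le; exact: md.
by apply/seteqP; split => p /wedgeE.
Qed.

Lemma area_wedge_gt0 v sg s : cmod v = 1 -> 0 < s <= 1 / 4 -> sg ^+ 2 = 1 ->
  0 < area (disc_sector (wedge v sg s) 0 1).
Proof.
move=> v1 /andP[s0 s1] sg2.
have vv : dot v v = 1 by rewrite -sqr_cmod v1 expr1n.
(* The point at height 1 / 2 on the middle direction, 1.4 s, of the wedge; a disc of radius s / 50
   around it fits. *)
pose c : R[i] := v * ((- (7 / 10 * s)) +i* (sg / 2)).
have dcv (x y : R) : dot (v * (x +i* y)) v = x /\ dot (v * (x +i* y)) ('i * v) = y.
  split.
    rewrite -[RHS]mulr1 -vv; case: (v) => [v2 v3]; rewrite /dot /=; ring.
  rewrite -[RHS]mulr1 -vv; case: (v) => [v2 v3]; rewrite /dot /=; ring.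
have [c1 c2] := dcv (- (7 / 10 * s)) (sg / 2).
have iv1 : cmod ('i * v) = 1.
  by rewrite cmodM v1 mulr1 /cmod /= expr0n expr1n add0r sqrtr1.
have [bU _] := area_disc_sector 0 (@cone_wedge v sg s) (@measurable_wedge v sg s) ltr01.
have s50 : 0 < s / 50 by rewrite divr_gt0.
apply: (area_gt0 (z := c) bU s50) => p; rewrite /disc /= => pc.
have dle w : cmod w = 1 -> `|dot p w - dot c w| <= s / 50.
  move=> w1; rewrite -dotNl -dotDl; apply: (le_trans (cauchy_schwarz _ _)).
  by rewrite w1 mulr1; exact: ltW.
have := dle _ v1; have := dle _ iv1; rewrite c1 c2.
set x := dot p v; set y := dot p ('i * v) => yy xx.
have sy : `|sg * y - 1 / 2| <= s / 50.
  have n1 : `|sg| = 1.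
    by apply/eqP; rewrite -(@eqrXn2 _ 2)// real_normK ?num_real// sg2 expr1n.
  have -> : sg * y - 1 / 2 = sg * (y - sg / 2).
    by rewrite mulrBr mulrA -expr2 sg2.
  by rewrite normrM n1 mul1r.
move: xx sy; rewrite !ler_norml => /andP[x1 x2] /andP[y1 y2].
apply/disc_sector0; split.
  by rewrite /wedge /= -/x -/y; apply/andP; split; nra.
rewrite (le_lt_trans (cmod_le_dots p v1))// -/x -/y.
have -> : `|x| = - x by rewrite ler0_norm; lra.
have -> : `|y| = sg * y.
  have n1 : `|sg| = 1.
    by apply/eqP; rewrite -(@eqrXn2 _ 2)// real_normK ?num_real// sg2 expr1n.
  by rewrite -[LHS]mul1r -n1 -normrM ger0_norm//; lra.
lra.
Qed.

Lemma wedge_bounds v sg s q : cmod v = 1 -> 0 < s <= 1 / 4 -> sg ^+ 2 = 1 ->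
  wedge v sg s q -> exists y, [/\ 0 <= y, dot q ('i * v) = sg * y,
    13 / 10 * s * y <= - dot q v <= 15 / 10 * s * y & cmod q <= 2 * y].
Proof.
move=> v1 /andP[s0 s1] sg2; rewrite /wedge /=.
set y := sg * dot q _ => /andP[q1 q2]; exists y.
have y0 : 0 <= y.
  have : 0 <= s * y by lra.
  by rewrite pmulr_rge0.
split => //; [by rewrite /y mulrA -expr2 sg2 mul1r|by rewrite q1|].
have n1 : `|sg| = 1.
  by apply/eqP; rewrite -(@eqrXn2 _ 2)// real_normK ?num_real// sg2 expr1n.
rewrite (le_trans (cmod_le_dots q v1))//.
have -> : `|dot q ('i * v)| = y by rewrite -[LHS]mul1r -n1 -normrM ger0_norm.
have sy : s * y <= 1 / 4 * y by exact: ler_wpM2r.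
have sy0 : 0 <= s * y by rewrite mulr_ge0// ltW.
by have -> : `|dot q v| = - dot q v; [rewrite ler0_norm; lra|lra].
Qed.

(** The margin is between 1.7 s, guaranteed by the slope of the step, and 1.5 s times 21/20, the
    worst contribution along [v]. *)
Lemma wedge_dot_step v sg s q (B X Y : R) : cmod v = 1 -> 0 < s <= 1 / 4 ->
  sg ^+ 2 = 1 -> 0 < B -> 19 / 20 <= X <= 21 / 20 -> `|Y| <= 1 ->
  17 / 10 * s <= sg * Y -> wedge v sg s q ->
  s / 50 * cmod (v * (B%:C * (X +i* Y))) * cmod q <= dot q (v * (B%:C * (X +i* Y))).
Proof.
move=> v1 s01 sg2 B0 /andP[Xb Xb'] Yb sgY Wq.
have [y [y0 yE /andP[q1 q2] qy]] := wedge_bounds v1 s01 sg2 Wq.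
have s0 : 0 < s by case/andP: s01.
have sy0 : 0 <= s * y by rewrite mulr_ge0// ltW.
have vB : cmod (v * (B%:C * (X +i* Y))) <= 41 / 20 * B.
  rewrite cmodM v1 mul1r cmodM cmodR gtr0_norm// mulrC ler_pM2r//.
  rewrite (le_trans (cmod_le_ReIm _))//= ger0_norm; lra.
apply: (@le_trans _ _ (s / 50 * (41 / 20 * B) * (2 * y))).
  apply: ler_pM; [|exact: cmod_ge0| |exact: qy].
    by rewrite mulr_ge0 ?cmod_ge0// divr_ge0// ltW.
  by rewrite ler_wpM2l// divr_ge0// ltW.
rewrite dot_decomp yE /= !mul0r subr0 addr0.
have -> : dot q v * (B * X) + sg * y * (B * Y) = B * (sg * Y * y - (- dot q v) * X) by ring.
have -> : s / 50 * (41 / 20 * B) * (2 * y) = B * (41 / 500 * s * y) by field.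
apply: ler_wpM2l; first exact: ltW.
have h1 : 17 / 10 * s * y <= sg * Y * y by exact: ler_wpM2r.
have h2 : - dot q v * X <= 15 / 10 * s * y * (21 / 20).
  by apply: ler_pM => //; lra.
lra.
Qed.

Lemma wedge_dot_ray v sg s q (x r : R) : cmod v = 1 -> 0 < s <= 1 / 4 ->
  sg ^+ 2 = 1 -> 0 < x -> sg * r <= 9 / 8 * s -> wedge v sg s q ->
  dot q (v * (x%:C * (1 +i* r))) <= - (s * x * (3 / 40)) * cmod q.
Proof.
move=> v1 s01 sg2 x0 rs Wq.
have [y [y0 yE /andP[q1 q2] qy]] := wedge_bounds v1 s01 sg2 Wq.
have s0 : 0 < s by case/andP: s01.
rewrite dot_decomp yE /= !mul0r subr0 addr0 mulr1.
have -> : dot q v * x + sg * y * (x * r) = (sg * r * y - (- dot q v)) * x by ring.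
have -> : - (s * x * (3 / 40)) * cmod q = - (s * (3 / 40) * cmod q) * x by ring.
apply: ler_wpM2r; first exact: ltW.
have h1 : sg * r * y <= 9 / 8 * s * y by exact: ler_wpM2r.
have h2 : s * cmod q <= s * (2 * y) by apply: ler_wpM2l => //; exact: ltW.
have sy0 : 0 <= s * y by rewrite mulr_ge0// ltW.
lra.
Qed.

End WedgeSets.

Section WedgeEstimate.
Context {R : realType}.
Variables (k : nat) (a v : R[i]) (b : R) (h : R[i]^o -> R[i]^o) (V : set R[i]^o).
Hypotheses (k0 : (0 < k)%N) (b0 : 0 < b) (v1 : cmod v = 1)
  (av : a * v ^+ k = - b%:C)
  (hV : forall eps : R, 0 < eps -> exists2 r : R, 0 < r & forall z, V z ->
     cmod z < r -> cmod (h z - z - a * z ^+ k.+1) <= eps * cmod z ^+ k.+1)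
  (secV : exists t r : R, [/\ 0 < t, 0 < r & forall x s, 0 < x < r -> `|s| <= t ->
     V (v * (x%:C * (1 +i* s)))])
  (orbV : forall z, V z -> (fun n => iter n h z) @ \oo --> (0 : R[i]^o)).
Variable e : R.
Hypothesis e0 : 0 < e.

Let Q := nbhd_quotient h e.
Let kappa := area (disc (0 : R[i]) e) / 2.

(* A far iterate w of z is negligible compared with z, and its disc covers the
   wedge part of the crescent, which would be left exposed if the orbit were
   straight. *)
Lemma wedge_estimate : exists2 t : R, 0 < t & forall s0 sg : R,
  0 < s0 <= t -> sg ^+ 2 = 1 ->
  exists delta r : R, [/\ 0 < delta, 0 < r & forall x s, 0 < x < r ->
    9 / 10 * s0 <= sg * s <= 9 / 8 * s0 ->
    complex.Re (Q (ray_point v x s)) <= kappa - delta].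
Proof.
have [t t0 [r r0 H]] := step_shrinks k0 b0 v1 av hV secV.
have [t' [t'0 t'1] H'] := small_step k0 b0 v1 av hV secV.
have k3 : 3 <= k.+2%:R :> R by rewrite ler_nat.
have kE : k.+2%:R = k.+1%:R + 1 :> R by rewrite natr1.
have t'6 : t' <= 1 / 6 by nra.
exists (Num.min t t' / 2); first by rewrite divr_gt0// lt_min t0.
move=> s0 sg /andP[s00 s0t] sg2.
have n1 : `|sg| = 1.
  by apply/eqP; rewrite -(@eqrXn2 _ 2)// real_normK ?num_real// sg2 expr1n.
have [s0t1 s0t2] : 2 * s0 <= t /\ 2 * s0 <= t'.
  have : 2 * s0 <= Num.min t t' by lra.
  by rewrite le_min => /andP[].
have s04 : s0 <= 1 / 4 by lra.
pose A := area (disc_sector (wedge v sg s0) 0 1).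
have A0 : 0 < A by apply: area_wedge_gt0 => //; rewrite s00.
pose c1 := s0 / 50.
have c10 : 0 < c1 by rewrite divr_gt0.
pose delta := c1 ^+ 2 * e ^+ 2 / 2 * A.
have delta0 : 0 < delta by rewrite mulr_gt0// divr_gt0// mulr_gt0// exprn_gt0.
pose c := 2 * area (disc (0 : R[i]) 1) * e.
have c0 : 0 < c by rewrite !mulr_gt0// area_disc1_gt0.
have [|r' /andP[r'0 _] {}H'] := H' (s0 / 20); first by rewrite divr_gt0.
(* Here e / 8 makes the step at most e / 2; s0 e / 180 gives |z - w|^2 <= 9 x^2 <= (s0 x / 20) e;
   and delta / (4 c) keeps the error c |z| below half of the loss, the other half being the [delta]
   returned. *)
exists (delta / 2), (Num.min (Num.min r r')
  (Num.min (Num.min (e / 8) (s0 * e / 180)) (delta / (4 * c)))).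
have c40 : 0 < 4 * c by rewrite mulr_gt0.
split; first by rewrite divr_gt0.
  by rewrite !lt_min r0 r'0 !divr_gt0// mulr_gt0.
move=> x s /andP[x0]; rewrite !lt_min.
move=> /andP[/andP[xr xr'] /andP[/andP[xe xs] xd]] /andP[sl su].
move: xd; rewrite ltr_pdivlMr// => xd.
have sE : `|s| = sg * s.
  by rewrite -[LHS]mul1r -n1 -normrM ger0_norm//; lra.
have [||s1 Vz hz hzz] := H x s; [by rewrite x0|by rewrite sE; lra|].
have [||_ bx [X [Y [E X1 Y1]]]] := H' x s; [by rewrite x0|by rewrite sE; lra|].
have /andP[_ zx] := cmod_ray_point v1 x0 s1.
set z := ray_point v x s in Vz hz hzz zx E *.
have bz := orbit_bounded orbV Vz.
have sx : 0 < s0 * x by exact: mulr_gt0.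
(* How late the iterate must be depends on [z], but the loss does not. Within s0 x / 40 of 0, it
   lowers the margin 3/40 of [wedge_dot_ray] to 1/20. *)
have [n0 Hn] : exists n0, forall n, (n0 <= n)%N -> cmod (iter n h z) <= s0 * x / 40.
  by apply: (orbit_small orbV Vz); rewrite divr_gt0.
have wn : cmod (iter n0 h (h z)) <= s0 * x / 40.
  by rewrite -iterSr; exact: Hn.
set w := iter n0 h (h z) in wn.
have [Xb Xb'] : 19 / 20 <= X /\ X <= 21 / 20.
  by move: X1; rewrite ler_norml => /andP[]; lra.
have sgY : 17 / 10 * s0 <= sg * Y.
  have : `|sg * Y - k.+1%:R * (sg * s)| <= 1 / 20 * (sg * s) + s0 / 20.
    have -> : sg * Y - k.+1%:R * (sg * s) = sg * (Y - k.+1%:R * s) by ring.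
    by rewrite normrM n1 -sE (mul1r `|_ - _|).
  rewrite ler_norml => /andP[+ _].
  have : 2 * (sg * s) <= k.+1%:R * (sg * s).
    by apply: ler_wpM2r; [lra|lra].
  lra.
have Yb : `|Y| <= 1.
  have := ler_normD (Y - k.+1%:R * s) (k.+1%:R * s); rewrite subrK.
  rewrite (normrM k.+1%:R) (ger0_norm (ler0n R k.+1)).
  have : k.+1%:R * `|s| <= k.+1%:R * t' by apply: ler_wpM2l => //; rewrite sE; lra.
  lra.
pose B := b * x ^+ k.+1.
have B0 : 0 < B by rewrite mulr_gt0// exprn_gt0.
have hzle : cmod (h z) <= cmod z by rewrite cmod_le ?cmod_ge0// sqr_cmod.
have Dle : cmod (z - h z) <= 4 * x.
  by have := cmodD z (- h z); rewrite cmodN; lra.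
have s01 : 0 < s0 <= 1 / 4 by rewrite s00.
have H1 q : wedge v sg s0 q -> c1 * cmod (z - h z) * cmod q <= dot q (z - h z).
  by rewrite E; apply: wedge_dot_step => //; rewrite Xb.
have H2 q : wedge v sg s0 q -> dot q (z - w) <= - (s0 * x / 20) * cmod q.
  move=> Wq; rewrite dotDr dotNr.
  have qw : - dot q w <= cmod q * (s0 * x / 40).
    rewrite (le_trans (ler_norm _))// normrN (le_trans (cauchy_schwarz _ _))//.
    by rewrite ler_wpM2l ?cmod_ge0.
  rewrite (le_trans (lerD (wedge_dot_ray v1 s01 sg2 x0 su Wq) qw))//.
  by rewrite le_eqVlt; apply/orP; left; apply/eqP; field.
have H3 : dot (z - w) (z - w) <= s0 * x / 20 * e.
  rewrite -sqr_cmod.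
  have : cmod (z - w) <= 3 * x.
    have := cmodD z (- w); rewrite cmodN.
    have : s0 * x <= 1 / 4 * x by apply: ler_wpM2r => //; exact: ltW.
    lra.
  rewrite -(@ler_pXn2r _ 2)// ?nnegrE ?cmod_ge0 ?mulr_ge0 ?(ltW x0)// => /le_trans; apply.
  have : 9 * x * x <= 9 * (s0 * e / 180) * x.
    by apply: ler_wpM2r; [exact: ltW|lra].
  lra.
have cc : 0 < c1 <= 1 by rewrite c10 /c1; lra.
have c20 : 0 < s0 * x / 20 by rewrite divr_gt0.
have De : 2 * cmod (z - h z) <= e by lra.
have := nbhd_quotient_wedge_le e0 bz hz hzz (@cone_wedge _ v sg s0)
  (@measurable_wedge _ v sg s0) cc c20 De H1 H2 H3.
rewrite -/c -/A -/delta -/kappa -/Q.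
have := ler_wpM2l (ltW c0) zx; lra.
Qed.

End WedgeEstimate.

(** * The rectangle and the conclusion by the maximum principle *)

Section Window.
Context {R : realFieldType}.
Implicit Types (l m x y : R).

Lemma window_slope l x y : 0 < l -> l <= 1 / 10 -> `|x - 1| <= l -> `|y| <= l / 2 ->
  [/\ 9 / 10 <= x <= 11 / 10, `|y / x| <= l &
   9 / 10 * (l / 2) <= l / 2 / x <= 9 / 8 * (l / 2)].
Proof.
move=> l0 l1; rewrite ler_norml => /andP[x1 x2] yl.
have x0 : 0 < x by lra.
split; first by apply/andP; split; lra.
  rewrite normrM [`|x^-1|]gtr0_norm ?invr_gt0// ler_pdivrMr//.
  have : l * (9 / 10) <= l * x by apply: ler_wpM2l; [exact: ltW|lra].
  lra.
have h1 : l * x <= l * (11 / 10) by apply: ler_wpM2l; [exact: ltW|lra].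
have h2 : l * (9 / 10) <= l * x by apply: ler_wpM2l; [exact: ltW|lra].
by rewrite ler_pdivlMr// ler_pdivrMr//; apply/andP; split; lra.
Qed.

(** The quadratic brings m l^2 / 2 on the vertical sides, where no loss is known, and costs at most
    as much on the horizontal ones, where the loss pays for it. *)
Lemma barrier_le l m x y : 0 < l -> 0 <= m -> `|y| <= l / 2 ->
  m * (2 * y ^+ 2 - (x - 1) ^+ 2) <= m * l ^+ 2 / 2 /\
  (`|x - 1| = l -> m * (2 * y ^+ 2 - (x - 1) ^+ 2) <= - (m * l ^+ 2) / 2).
Proof.
move=> l0 m0 yl.
have y2 : y ^+ 2 <= (l / 2) ^+ 2.
  by rewrite -(real_normK (num_real y)) lerXn2r// nnegrE// ltW// divr_gt0.
split=> [|xl].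
  have -> : m * l ^+ 2 / 2 = m * (2 * (l / 2) ^+ 2) by field.
  by apply: ler_wpM2l => //; have := sqr_ge0 (x - 1); lra.
have x2 : (x - 1) ^+ 2 = l ^+ 2 by rewrite -(real_normK (num_real (x - 1))) xl.
have -> : - (m * l ^+ 2) / 2 = m * (2 * (l / 2) ^+ 2 - l ^+ 2) by field.
by apply: ler_wpM2l => //; rewrite x2; lra.
Qed.

End Window.

Section NonAnalyticity.
Context {R : realType}.
Variables (k : nat) (a v : R[i]) (b : R) (h : R[i]^o -> R[i]^o) (V : set R[i]^o).
Hypotheses (k0 : (0 < k)%N) (b0 : 0 < b) (v1 : cmod v = 1)
  (av : a * v ^+ k = - b%:C)
  (hV : forall eps : R, 0 < eps -> exists2 r : R, 0 < r & forall z, V z ->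
     cmod z < r -> cmod (h z - z - a * z ^+ k.+1) <= eps * cmod z ^+ k.+1)
  (secV : exists t r : R, [/\ 0 < t, 0 < r & forall x s, 0 < x < r -> `|s| <= t ->
     V (v * (x%:C * (1 +i* s)))])
  (orbV : forall z, V z -> (fun n => iter n h z) @ \oo --> (0 : R[i]^o)).
Variable e : R.
Hypothesis e0 : 0 < e.

Let Q := nbhd_quotient h e.
Let kappa := area (disc (0 : R[i]) e) / 2.

Hypotheses (invV : forall z, V z -> V (h z))
  (hT : exists2 r : R, 0 < r & forall z, V z -> cmod z < r -> taylor2 h z).

(* The real part of the quotient at lam v (x + i y), for lam small, is at most
   kappa + o(1), tends to kappa at x + i y = 1 and is at most kappa - d for
   y = l / 2 or - l / 2: this contradicts the maximum principle. *)
Lemma nbhd_measure_not_analytic : ~ analytic_on (nbhd_measure h e) V.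
Proof.
move=> aF.
have [t3 t30 [r3 r30 H3]] := step_shrinks k0 b0 v1 av hV secV.
have [rT rT0 HT] := hT.
have [t1 t10 H1] := upper_estimate k0 b0 v1 av hV secV orbV e0.
have [t2 t20 H2] := wedge_estimate k0 b0 v1 av hV secV orbV e0.
pose l := Num.min (1 / 10) (Num.min t1 (Num.min t2 t3)).
have l0 : 0 < l by rewrite !lt_min t10 t20 t30 divr_gt0.
have [l1 lt1 lt2 lt3] : [/\ l <= 1 / 10, l <= t1, l <= t2 & l <= t3].
  have : l <= l by []; rewrite {2}/l !le_min => /andP[-> /andP[-> /andP[-> ->]]].
  by [].
pose s0 := l / 2.
have s00 : 0 < s0 <= t2 by rewrite /s0; apply/andP; split; lra.
have [dp [rp [dp0 rp0 Hp]]] := H2 s0 1 s00 (expr1n _ 2).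
have [|dm [rm [dm0 rm0 Hm]]] := H2 s0 (-1) s00; first by rewrite sqrrN expr1n.
pose d := Num.min dp dm.
have d0 : 0 < d by rewrite lt_min dp0.
have d80 : 0 < d / 8 by rewrite divr_gt0.
have [r1 r10 {}H1] := H1 _ d80.
have [r4 r40 H4] := lower_estimate k0 b0 v1 av hV secV orbV e0 d80.
rewrite -/Q -/kappa in Hp Hm H1 H4.
pose rho := Num.min (Num.min r3 rT) (Num.min (Num.min rp rm) (Num.min r1 r4)).
have rho0 : 0 < rho by rewrite !lt_min r30 rT0 rp0 rm0 r10 r40.
(* On the rectangle x <= 11/10, so 2 lam x < rho; the factor 2 bounds the modulus of the point. *)
pose lam := rho / 5.
have lam0 : 0 < lam by rewrite divr_gt0.
have lamr x : `|x - 1| <= l -> 0 < x /\ [/\ 0 < lam * x < r3, 2 * (lam * x) < rT,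
    0 < lam * x < rp, 0 < lam * x < rm & 0 < lam * x < r1].
  move=> xl; have y0 : `|0 : R| <= l / 2 by rewrite normr0 divr_ge0// ltW.
  have [/andP[x1 x2] _ _] := window_slope l0 l1 xl y0.
  have x0 : 0 < x by exact: lt_le_trans x1.
  have lx0 : 0 < lam * x by exact: mulr_gt0.
  have lx : 2 * (lam * x) < rho.
    have := ler_wpM2l (ltW lam0) x2; rewrite {2}/lam; lra.
  split => //; move: lx; rewrite /rho !lt_min.
  move=> /andP[/andP[a1 a2] /andP[/andP[a3 a4] /andP[a5 a6]]].
  have lxlx : lam * x < 2 * (lam * x) by lra.
  by split => //; rewrite lx0 /=; apply: lt_trans lxlx _.
pose q := Q \o (fun w : R[i] => (lam%:C * v) * w + 0).
have qE x y : 0 < x -> (lam%:C * v) * (x +i* y) + 0 = ray_point v (lam * x) (y / x).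
  move=> x0; rewrite addr0 /ray_point (mulrC lam%:C) -mulrA; congr (_ * _).
  apply/eqP; rewrite eq_complex /= !mul0r !subr0 !addr0 mulr1 eqxx /=.
  by apply/eqP; field; rewrite gt_eqF.
have sle x y : `|x - 1| <= l -> `|y| <= l / 2 -> `|y / x| <= l.
  by move=> xl yl; have [] := window_slope l0 l1 xl yl.
have tq x y : `|x - 1| <= l -> `|y| <= l / 2 -> taylor2 q (x +i* y).
  move=> xl yl; have [x0 [x3 xT _ _ _]] := lamr x xl.
  have sl := sle x y xl yl.
  apply: taylor2_comp; last exact: taylor2_affine.
  rewrite qE//.
  have [s1 Vz hz _] := H3 _ _ x3 (le_trans sl lt3).
  have /andP[lx0 _] := x3.
  have /andP[_ zx] := cmod_ray_point v1 lx0 s1.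
  set z := ray_point v _ _ in Vz hz zx *.
  have Th : taylor2 h z by apply: HT => //; exact: le_lt_trans xT.
  apply: taylor2_div.
  - apply: taylor2B; first exact: analytic_taylor2 aF Vz.
    apply: (@taylor2_comp _ (nbhd_measure h e) h z) => //.
    exact: analytic_taylor2 aF (invV Vz).
  - by apply: taylor2B => //; exact: taylor2_id.
  - by rewrite subr_eq0 eq_sym.
have l20 : 0 < l ^+ 2 by rewrite exprn_gt0.
(* The quadratic is then at most d / 2, and at most -d / 2 on the vertical sides. *)
pose m := d / l ^+ 2.
have m0 : 0 < m by rewrite divr_gt0.
have ml : m * l ^+ 2 = d by rewrite /m mulfVK// gt_eqF.
have [ddp ddm] : d <= dp /\ d <= dm by rewrite !ge_min !lexx orbT.
(* Vertical sides: (kappa + d / 8) - d / 2. Horizontal sides: (kappa - d) + d / 2, which is smaller.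
   The centre has at least kappa - d / 8, a contradiction. *)
have : complex.Re (q 1) <= kappa + d / 8 - d / 2.
  apply: (@rectangle_max _ q l m) => // x y xl yl bd.
  have [x0 [x3 xT xp xm x1]] := lamr x xl.
  have sl := sle x y xl yl.
  rewrite /q /= qE//.
  have [mm1 mm2] := barrier_le x l0 (ltW m0) yl.
  rewrite ml in mm1 mm2; case: bd => bd.
    have := H1 _ _ x1 (le_trans sl lt1); have := mm2 bd; lra.
  have [_ _ sb] := window_slope l0 l1 xl yl; rewrite -/s0 in sb.
  have [y0|y0] := leP 0 y.
    have yE : y = s0 by rewrite /s0 -bd ger0_norm.
    have Hy : 9 / 10 * s0 <= 1 * (y / x) <= 9 / 8 * s0 by rewrite mul1r yE.
    have := Hp _ _ xp Hy; lra.
  have yE : y = - s0 by rewrite /s0 -bd ltr0_norm// opprK.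
  have Hy : 9 / 10 * s0 <= -1 * (y / x) <= 9 / 8 * s0.
    by rewrite yE mulN1r mulNr opprK.
  have := Hm _ _ xm Hy; lra.
have q1 : q 1 = Q (ray_point v lam 0).
  by rewrite /q /= -[1]/(1 +i* 0) qE// mulr1 mul0r.
have : kappa - d / 8 <= complex.Re (q 1).
  rewrite q1; apply: H4; rewrite lam0 /=.
  have : lam < rho by rewrite /lam; lra.
  by rewrite /rho !lt_min => /andP[_ /andP[_ /andP[_ ->]]].
lra.
Qed.

End NonAnalyticity.

(** * The inverse germ *)

Section LocalInverse.
Context {R : realType}.
Implicit Types (F : R[i] -> R[i]) (z w : R[i]).

Lemma cmod_subX_le w w' (t : R) n : cmod w <= t -> cmod w' <= t ->
  cmod (w ^+ n.+1 - w' ^+ n.+1) <= (2 * t) ^+ n * cmod (w - w').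
Proof.
move=> wt wt'; have t0 : 0 <= t by rewrite (le_trans _ wt)// cmod_ge0.
elim: n => [|n IH]; first by rewrite !expr1 expr0 mul1r.
have -> : w ^+ n.+2 - w' ^+ n.+2 =
  w * (w ^+ n.+1 - w' ^+ n.+1) + (w - w') * w' ^+ n.+1.
  by rewrite !(exprS _ n.+1); ring.
rewrite (le_trans (cmodD _ _))// !(cmodM _ (_ - _)) (cmodM (w - w')) (cmodX w').
have h1 : cmod w * cmod (w ^+ n.+1 - w' ^+ n.+1) <= t * ((2 * t) ^+ n * cmod (w - w')).
  by apply: ler_pM => //; exact: cmod_ge0.
have h2 : cmod w' ^+ n.+1 <= t * (2 * t) ^+ n.
  rewrite exprS; apply: ler_pM => //; rewrite ?cmod_ge0 ?exprn_ge0 ?cmod_ge0//.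
  by rewrite lerXn2r ?nnegrE ?cmod_ge0 ?mulr_ge0// (le_trans wt')// ler_peMl// ler1n.
have := ler_wpM2l (cmod_ge0 (w - w')) h2.
have := cmod_ge0 (w - w').
rewrite [(2 * t) ^+ n.+1]exprS.
set d := cmod (w - w') in h1 *; set p := (2 * t) ^+ n in h1 h2 * => d0 h3.
lra.
Qed.

(** Strict differentiability: near z, [F] differs from its linear part by a map of small Lipschitz
    constant, which is what makes [f] locally invertible at 0. *)
Lemma analytic_lipschitz F (V : set R[i]^o) z : analytic_on F V -> V z ->
  exists (c1 : R[i]) (K r : R), [/\ 0 < r, 0 <= K & forall w w' t,
    cmod w <= t -> cmod w' <= t -> t <= r ->
    cmod (F (z + w) - F (z + w') - c1 * (w - w')) <= K * t * cmod (w - w')].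
Proof.
move=> aF Vz; have [c [M [r [r0 M0 cM cF]]]] := analytic_expansion aF Vz.
exists (c 1%N), (4 * M / r ^+ 2), (r / 4); split.
- by rewrite divr_gt0.
- by apply: divr_ge0; [exact: mulr_ge0|exact: sqr_ge0].
move=> w w' t wt wt' tr.
have t0 : 0 <= t by rewrite (le_trans _ wt)// cmod_ge0.
set d := cmod (w - w'); have d0 : 0 <= d by exact: cmod_ge0.
pose p := 2 * t / r.
have p0 : 0 <= p by rewrite divr_ge0 ?mulr_ge0// ltW.
have p2 : 2 * p <= 1 by rewrite /p mulrA ler_pdivrMr//; lra.
pose u n := partial_sum c w n - partial_sum c w' n.
have Mr : 0 <= M / r * d by rewrite mulr_ge0// divr_ge0// ltW.
(* The geometric tail again, of ratio p <= 1/2; the n-th power differs at two points of modulus at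
   most t by at most (2 t)^(n-1) times their distance. *)
have H n : cmod (u n.+2 - c 1%N * (w - w')) <= M / r * d * (2 * p - 2 * p ^+ n.+1).
  elim: n => [|n IH].
    rewrite /u !partial_sumS /partial_sum !big_geq// !expr0 !expr1 subrr mulr0.
    by rewrite [X in cmod X](_ : _ = 0) ?cmod0//; ring.
  have -> : u n.+3 - c 1%N * (w - w') = (u n.+2 - c 1%N * (w - w'))
      + c n.+2 * (w ^+ n.+2 - w' ^+ n.+2).
    by rewrite /u !(partial_sumS _ _ n.+2); ring.
  have h1 : cmod (c n.+2 * (w ^+ n.+2 - w' ^+ n.+2)) <= M / r * d * p ^+ n.+1.
    rewrite cmodM; have := ler_wpM2l (cmod_ge0 (c n.+2)) (cmod_subX_le n.+1 wt wt').
    move=> /le_trans; apply; rewrite -/d /p expr_div_n.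
    have -> : M / r * d * ((2 * t) ^+ n.+1 / r ^+ n.+1) =
      M / r ^+ n.+2 * ((2 * t) ^+ n.+1 * d).
      have rn : r ^+ n.+1 != 0 by rewrite expf_neq0// gt_eqF.
      rewrite [r ^+ n.+2]exprS; move: (r ^+ n.+1) ((2 * t) ^+ _) rn => y x rn.
      by field; rewrite rn gt_eqF.
    apply: ler_wpM2r; first by rewrite mulr_ge0// exprn_ge0// mulr_ge0.
    by rewrite ler_pdivlMr// exprn_gt0.
  rewrite (le_trans (cmodD _ _))// (le_trans (lerD IH h1))// -mulrDr.
  apply: ler_wpM2l => //; rewrite [p ^+ n.+2]exprS.
  have := exprn_ge0 n.+1 p0; set y := p ^+ n.+1 => y0; nra.
have rr4 : r / 4 <= r by rewrite ler_pdivrMr//; lra.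
have wr : cmod w <= r by lra.
have wr' : cmod w' <= r by lra.
apply: (@le_trans _ _ (M / r * d * (2 * p))).
  apply: (@cmod_limit_le _ _ _ u).
    move=> eps eps0; have e20 : 0 < eps / 2 by rewrite divr_gt0.
    have [n1 H1] := cF w wr _ e20; have [n2 H2] := cF w' wr' _ e20.
    exists (maxn n1 n2) => n; rewrite geq_max => /andP[/H1 h1 /H2 h2].
    have -> : F (z + w) - F (z + w') - u n = (F (z + w) - partial_sum c w n)
      + - (F (z + w') - partial_sum c w' n) by rewrite /u; ring.
    by rewrite (le_trans (cmodD _ _))// cmodN; lra.
  exists 2%N => -[|[|n]]// _; apply: (le_trans (H n)).
  by apply: ler_wpM2l => //; rewrite gerBl mulr_ge0// exprn_ge0.
rewrite le_eqVlt; apply/orP; left; apply/eqP; rewrite /p.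
by field; rewrite gt_eqF.
Qed.

Variables (f : R[i] -> R[i]) (rho : R).
Hypotheses (rho0 : 0 < rho) (f0 : f 0 = 0)
  (fL : forall w w', cmod w < rho -> cmod w' < rho ->
     cmod (f w - f w' - (w - w')) <= 1 / 2 * cmod (w - w'))
  (fT : forall w, cmod w < rho -> taylor2 f w).

Lemma local_expanding w w' : cmod w < rho -> cmod w' < rho ->
  cmod (w - w') <= 2 * cmod (f w - f w').
Proof.
move=> wr wr'; have := fL wr wr'.
have := cmodD_sub (w - w') (f w - f w' - (w - w')).
have -> : w - w' + (f w - f w' - (w - w')) = f w - f w' by ring.
lra.
Qed.

Lemma cmod_local_le w : cmod w < rho -> cmod w <= 2 * cmod (f w).
Proof.
have z0 : cmod (0 : R[i]) < rho by rewrite cmod0.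
by move=> wr; have := local_expanding wr z0; rewrite f0 !subr0.
Qed.

(* At a minimum z of |f z - w| the point z + (w - f z) would do better. *)
Lemma local_surjective w : 10 * cmod w < rho ->
  exists2 z, cmod z < rho & f z = w.
Proof.
(* A minimum has |z| <= 4 |w| and |f z - w| <= |w|, so the competitor z + (w - f z) stays in the
   square of half-side 5 |w|, where moduli are at most 10 |w| < rho. *)
move=> wr; pose s := 5 * cmod w.
have w0 := cmod_ge0 w.
have s0 : 0 <= s by rewrite mulr_ge0.
have sq x y : - s <= x <= s -> - s <= y <= s -> cmod (x +i* y) < rho.
  rewrite -!ler_norml => xs ys; rewrite (le_lt_trans (cmod_le_ReIm _))//=.
  by rewrite (le_lt_trans (lerD xs ys))// /s; lra.
have [||x y xs ys|x0 [y0 [x0s y0s H]]] := @rectangle_EVT _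
    (fun p : R * R => - cmod (f (p.1 +i* p.2) - w)) (- s) s (- s) s.
- lra.
- lra.
- apply: (@taylor2_continuous _ (fun u => - cmod (u - w)) f (x, y)).
    move=> b c; rewrite opprK addrC ler_norml.
    have h1 := cmodD_sub (b - w) (c - b); have h2 := cmodD_sub (c - w) (b - c).
    rewrite (cmodB c b) in h1; move: h1 h2.
    have -> : b - w + (c - b) = c - w by ring.
    have -> : c - w + (b - c) = b - w by ring.
    by move=> h1 h2; apply/andP; split; lra.
  by apply: fT; exact: sq.
set z := x0 +i* y0 in H; exists z; first exact: sq.
have zr : cmod z < rho by exact: sq.
apply/eqP; rewrite -subr_eq0 -cmod_eq0 eq_le cmod_ge0 andbT.
have d0 := cmod_ge0 (f z - w).
have fzw : cmod (f z - w) <= cmod w.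
  have := H 0 0; rewrite /= (_ : Complex 0 0 = 0)// f0 sub0r cmodN lerN2.
  by apply; apply/andP; split; lra.
have zw : cmod z <= 4 * cmod w.
  have := cmod_local_le zr; have := cmodD (f z - w) w; rewrite subrK; lra.
pose u := z + (w - f z).
have us : cmod u <= s.
  by rewrite (le_trans (cmodD _ _))// (cmodB w) /s; lra.
have ur : cmod u < rho by rewrite /s in us; lra.
have := fL ur zr.
have -> : f u - f z - (u - z) = f u - w by rewrite /u; ring.
have -> : u - z = - (f z - w) by rewrite /u; ring.
rewrite cmodN.
have := H (complex.Re u) (complex.Im u).
rewrite -!ler_norml (le_trans (Re_le_cmod u) us) (le_trans (Im_le_cmod u) us).
move=> /(_ isT isT); rewrite /= lerN2 (_ : complex.Re u +i* complex.Im u = u).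
  by lra.
by case: (u).
Qed.

End LocalInverse.

(** * From petals and germs to the normalized setting *)

Section Petals.
Context {R : realType}.
Implicit Types (k : nat) (a v : R[i]) (N V D : set R[i]^o) (f g h : R[i]^o -> R[i]^o).

(** Treats [f] and its inverse at once, [h] standing for either. Rescaling [v] to modulus 1 turns
    the sign condition on a v^k into the value -b, with b > 0. *)
Lemma petal_not_analytic k a D h V (e : R) : (0 < k)%N ->
  attracting_petal k a D h V -> 0 < e ->
  (forall eps : R, 0 < eps -> exists2 r : R, 0 < r & forall z, V z ->
     cmod z < r -> cmod (h z - z - a * z ^+ k.+1) <= eps * cmod z ^+ k.+1) ->
  (exists2 r : R, 0 < r & forall z, V z -> cmod z < r -> taylor2 h z) ->
  ~ analytic_on (fun z => complex_measure (eps_nbhd e (dyn_orbit h z))) V.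
Proof.
move=> k0 [_ invV orbV [v [av [t [r [t0 r0 sV]]]]]] e0 hV hT.
have v0 : v != 0.
  by apply/eqP => vE; move: av; rewrite /attracting_direction vE expr0n gtn_eqF// mulr0 ltxx.
pose c := cmod v; have c0 : 0 < c by rewrite cmod_gt0.
pose v' := (c^-1)%:C * v.
have v'1 : cmod v' = 1.
  by rewrite cmodM cmodR ger0_norm ?invr_ge0 ?ltW// mulVf// gt_eqF.
move: av; rewrite /attracting_direction ltcE => /andP[/eqP im0 re0].
pose b := - complex.Re (a * v ^+ k) * c^-1 ^+ k.
have b0 : 0 < b by rewrite mulr_gt0 ?oppr_gt0// exprn_gt0// invr_gt0.
have avE : a * v' ^+ k = - b%:C.
  have avk : a * v ^+ k = (complex.Re (a * v ^+ k))%:C.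
    by apply/eqP; rewrite eq_complex /= eqxx -im0 /=.
  rewrite /v' exprMn mulrCA avk -rmorphXn -rmorphM -rmorphN; congr (_%:C).
  by rewrite /b; ring.
apply: (@nbhd_measure_not_analytic _ k a v' b h V) => //.
(* The sector is open, so the slope must stay strictly below t; slopes at most 1 give |z| <= 2 x,
   whence r / 2. *)
exists (Num.min (t / 2) 1), (r / 2); split.
- by rewrite lt_min ltr01 divr_gt0.
- by rewrite divr_gt0.
move=> x s /andP[x0 xr]; rewrite le_min => /andP[st s1]; apply: sV.
have /andP[zx zx2] := cmod_ray_point v'1 x0 s1.
rewrite -/(ray_point v' x s); split.
- by rewrite -cmod_gt0 (lt_le_trans x0).
- by rewrite normE ltcR; lra.
have -> : ray_point v' x s / v = (c^-1 * x) +i* (c^-1 * x * s).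
  have -> : ray_point v' x s / v = (c^-1)%:C * (x%:C * (1 +i* s)).
    by rewrite /ray_point /v' mulrAC mulfK// mulrAC mulfK.
  by apply/eqP; rewrite eq_complex /=; apply/andP; split; apply/eqP; ring.
rewrite /= normrM gtr0_norm; last by rewrite mulr_gt0// invr_gt0.
rewrite mulrC ltr_pM2r; last by rewrite mulr_gt0// invr_gt0.
lra.
Qed.

Lemma parabolic_expansion k a N f g (eps : R) : parabolic_diffeo k a N f g ->
  0 < eps -> exists2 r : R, 0 < r & forall z, cmod z < r ->
     cmod (f z - z - a * z ^+ k.+1) <= eps * cmod z ^+ k.+1.
Proof.
move=> [_ _ _ /eqoP H] eps0; have := H eps%:C; rewrite ltcR => /(_ eps0).
move=> /nbhs_cmod[r r0 Hr]; exists r => // z zr.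
have := Hr z; rewrite sub0r cmodN => /(_ zr).
by rewrite !normE -rmorphM lecR cmodX.
Qed.

Lemma parabolic_near_id k a N f g : (0 < k)%N -> parabolic_diffeo k a N f g ->
  exists2 rho : R, 0 < rho & [/\ f 0 = 0,
    (forall w w', cmod w < rho -> cmod w' < rho ->
       cmod (f w - f w' - (w - w')) <= 1 / 2 * cmod (w - w')),
    (forall w, cmod w < rho -> N w) &
    forall w, cmod w < rho -> taylor2 f w].
Proof.
move=> k0 pf; have [[oN N0] aN gf _] := pf.
have [r1 r10 H1] := parabolic_expansion pf ltr01.
have f0 : f 0 = 0.
  have := H1 0; rewrite cmod0 => /(_ r10).
  rewrite !expr0n /= mulr0 !subr0 mulr0 => f0.
  by apply/eqP; rewrite -cmod_eq0 eq_le cmod_ge0 andbT.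
have [c1 [K [r [r0 K0 HL]]]] := analytic_lipschitz aN N0.
(* The power series and the germ expansion are compared at small real x: |c1 - 1| x <= B x^2,
   because x^(k+1) <= x^2. *)
have c11 : c1 = 1.
  apply/eqP; rewrite -subr_eq0 -cmod_eq0 eq_le cmod_ge0 andbT.
  pose B := K + cmod a + 1.
  have B0 : 0 < B by rewrite ltr_wpDl// addr_ge0// cmod_ge0.
  apply/ler_addgt0Pr => eps eps0; rewrite add0r.
  pose x := Num.min (Num.min r1 r) (Num.min 1 (eps / B)) / 2.
  have m0 : 0 < Num.min (Num.min r1 r) (Num.min 1 (eps / B)).
    by rewrite !lt_min r10 r0 ltr01 divr_gt0.
  have x0 : 0 < x by rewrite divr_gt0.
  have : x < Num.min (Num.min r1 r) (Num.min 1 (eps / B)) by rewrite /x; lra.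
  rewrite !lt_min => /andP[/andP[xr1 xr] /andP[x1 xB]].
  have xc : cmod x%:C = x by rewrite cmodR gtr0_norm.
  have h1 := H1 x%:C; rewrite xc in h1; have {}h1 := h1 xr1.
  have := HL x%:C 0 x; rewrite xc cmod0 !subr0 !add0r f0 subr0 xc.
  move=> /(_ (lexx _) (ltW x0) (ltW xr)) h2.
  have h3 : cmod ((c1 - 1) * x%:C) <= B * x * x.
    have -> : (c1 - 1) * x%:C = (f x%:C - x%:C - a * x%:C ^+ k.+1)
      - (f x%:C - c1 * x%:C) + a * x%:C ^+ k.+1 by ring.
    have xk : x ^+ k.+1 <= x * x.
      rewrite exprS; apply: ler_wpM2l; first exact: ltW.
      by rewrite -(prednK k0) exprS ler_piMr ?(ltW x0)// exprn_ile1 ?(ltW x0) ?(ltW x1).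
    have h4 : cmod (a * x%:C ^+ k.+1) <= cmod a * (x * x).
      by rewrite cmodM cmodX xc ler_wpM2l// cmod_ge0.
    apply: le_trans (cmodD _ _) _.
    have := cmodD (f x%:C - x%:C - a * x%:C ^+ k.+1) (- (f x%:C - c1 * x%:C)).
    rewrite cmodN /B; lra.
  move: h3; rewrite cmodM xc ler_pM2r// => /le_trans; apply.
  by move: xB; rewrite ltr_pdivlMr// mulrC => /ltW.
have [r2 r20 HN] : exists2 r2, 0 < r2 & forall w, cmod w < r2 -> N w.
  have /nbhs_cmod[r2 r20 HN] : nbhs (0 : R[i]^o) N by exact: open_nbhs_nbhs.
  by exists r2 => // w wr; apply: HN; rewrite sub0r cmodN.
pose rho := Num.min (Num.min r r2) (1 / 2 / (K + 1)).
have K1 : 0 < K + 1 by rewrite ltr_wpDl.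
have rho0 : 0 < rho by rewrite !lt_min r0 r20 !divr_gt0.
have [rr rr2 rK] : [/\ rho <= r, rho <= r2 & rho <= 1 / 2 / (K + 1)].
  have : rho <= rho by [].
  by rewrite {2}/rho !le_min => /andP[/andP[-> ->] ->].
exists rho => //; split => //.
- move=> w w' wr wr'; have := HL w w' rho (ltW wr) (ltW wr') rr.
  rewrite !add0r c11 mul1r => /le_trans; apply; apply: ler_wpM2r; first exact: cmod_ge0.
  move: rK; rewrite ler_pdivlMr// => rK; have := ltW rho0; lra.
- by move=> w wr; apply: HN; exact: lt_le_trans rr2.
- by move=> w wr; apply: (analytic_taylor2 aN); apply: HN; exact: lt_le_trans rr2.
Qed.

(** With w = f z, the remainder of [g] at w is a (f(z)^(k+1) - z^(k+1)) minus the remainder of [f]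
    at z. As f z - z = O(z^(k+1)), the first term is O(z^(2k+1)), negligible for k >= 1; and |z| <=
    2 |w| converts powers of z into powers of w. *)
Lemma inverse_expansion k a N f g : (0 < k)%N -> parabolic_diffeo k a N f g ->
  (forall eps : R, 0 < eps -> exists2 r : R, 0 < r & forall w, cmod w < r ->
     cmod (g w - w - - a * w ^+ k.+1) <= eps * cmod w ^+ k.+1) /\
  (exists2 r : R, 0 < r & forall w, cmod w < r -> taylor2 g w).
Proof.
move=> k0 pf; have [rho rho0 [f0 fL fN fT]] := parabolic_near_id k0 pf.
have [_ _ gf _] := pf.
(* [g] is given as a left inverse on [N]; local surjectivity of [f] makes it a right inverse near 0
   and puts its values there near 0. *)
have surj w : 10 * cmod w < rho -> [/\ cmod (g w) < rho, f (g w) = w &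
    cmod (g w) <= 2 * cmod w].
  move=> wr; have [z zr fz] := local_surjective rho0 f0 fL fT wr.
  have gw : g w = z by rewrite -fz gf//; exact: fN.
  by rewrite gw fz; split => //; rewrite -fz; exact: cmod_local_le rho0 f0 fL _ zr.
split; last first.
  exists (rho / 20); first by rewrite divr_gt0.
  move=> w wr; have [gr fg _] : [/\ cmod (g w) < rho, f (g w) = w & cmod (g w) <= 2 * cmod w].
    by apply: surj; have := cmod_ge0 w; lra.
  apply: (@taylor2_inverse _ f); first exact: fT.
  exists 2, (rho / 20); split; [by rewrite divr_gt0|by []|].
  move=> u ur; have [gr' fg' _] : [/\ cmod (g (w + u)) < rho, f (g (w + u)) = w + u &
      cmod (g (w + u)) <= 2 * cmod (w + u)].
    by apply: surj; have := cmodD w u; lra.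
  split => //; have := local_expanding fL gr' gr.
  by rewrite fg fg' (_ : w + u - w = u)//; ring.
move=> eps eps0.
pose P : R := 2 ^+ k.+1.
have P0 : 0 < P by rewrite exprn_gt0.
pose eps' := eps / 2 / P.
have eps'0 : 0 < eps' by rewrite !divr_gt0.
have [r1 r10 H1] := parabolic_expansion pf eps'0.
have [r2 r20 H2] := parabolic_expansion pf ltr01.
pose B := cmod a * 4 ^+ k * (1 + cmod a).
have B0 : 0 <= B by rewrite mulr_ge0 ?addr_ge0 ?cmod_ge0// mulr_ge0 ?cmod_ge0// exprn_ge0.
have B1 : 0 < B + 1 by rewrite ltr_wpDl.
exists (Num.min (rho / 10) (Num.min (Num.min r1 r2) (Num.min 1 (eps' / (B + 1))) / 2)).
  by rewrite lt_min !divr_gt0// !lt_min r10 r20 ltr01 divr_gt0.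
move=> w; rewrite lt_min => /andP[w1 w2].
have [zr fz zw] : [/\ cmod (g w) < rho, f (g w) = w & cmod (g w) <= 2 * cmod w].
  by apply: surj; lra.
set z := g w in zr fz zw *.
have : cmod z < Num.min (Num.min r1 r2) (Num.min 1 (eps' / (B + 1))) by lra.
rewrite !lt_min => /andP[/andP[zr1 zr2] /andP[z1 zB]].
have z0 := cmod_ge0 z; have a0 := cmod_ge0 a.
have h1 := H1 z zr1; have h2 := H2 z zr2.
set y := cmod z ^+ k.+1 in h1 h2.
have y0 : 0 <= y by exact: exprn_ge0.
have fzz : cmod (f z - z) <= (1 + cmod a) * y.
  have -> : f z - z = (f z - z - a * z ^+ k.+1) + a * z ^+ k.+1 by ring.
  by rewrite (le_trans (cmodD _ _))// (cmodM a) cmodX -/y; lra.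
have fz2 : cmod (f z) <= 2 * cmod z.
  have z00 : cmod (0 : R[i]) < rho by rewrite cmod0.
  have := fL z 0 zr z00; rewrite f0 !subr0 => h3.
  by have := cmodD (f z - z) z; rewrite subrK; lra.
have z2 : cmod z <= 2 * cmod z by lra.
have h3 := cmod_subX_le k fz2 z2.
have h4 : cmod (a * (f z ^+ k.+1 - z ^+ k.+1)) <= eps' * y.
  rewrite cmodM; apply: (@le_trans _ _ (cmod a * ((2 * (2 * cmod z)) ^+ k * ((1 + cmod a) * y)))).
    apply: ler_wpM2l => //; apply: (le_trans h3); apply: ler_wpM2l => //.
    by rewrite exprn_ge0// !mulr_ge0.
  have -> : 2 * (2 * cmod z) = 4 * cmod z by ring.
  rewrite exprMn.
  have -> : cmod a * (4 ^+ k * cmod z ^+ k * ((1 + cmod a) * y)) = B * cmod z ^+ k * y.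
    by rewrite /B; ring.
  apply: ler_wpM2r => //.
  have zk : cmod z ^+ k <= cmod z.
    by rewrite -(prednK k0) exprS ler_piMr// exprn_ile1// ltW.
  apply: (@le_trans _ _ (B * cmod z)); first exact: ler_wpM2l.
  by move: zB; rewrite ltr_pdivlMr//; lra.
have yw : y <= P * cmod w ^+ k.+1.
  by rewrite /y /P -exprMn lerXn2r// nnegrE ?cmod_ge0// mulr_ge0// cmod_ge0.
have -> : z - w - - a * w ^+ k.+1 =
    a * (f z ^+ k.+1 - z ^+ k.+1) - (f z - z - a * z ^+ k.+1) by rewrite fz; ring.
apply: le_trans (cmodD _ _) _; rewrite cmodN.
apply: (@le_trans _ _ (2 * eps' * y)); first lra.
apply: (@le_trans _ _ (2 * eps' * (P * cmod w ^+ k.+1))).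
  by apply: ler_wpM2l => //; rewrite mulr_ge0// ltW.
rewrite le_eqVlt; apply/orP; left; apply/eqP; rewrite /eps'.
by field; rewrite gt_eqF.
Qed.

End Petals.

Theorem proposition4p4 (R : realType) (k : nat) (a : R[i]^o)
    (N : set (R[i]^o)) (f g : R[i]^o -> R[i]^o) (e : R)
    (hk : (0 < k)%N) (ha : a != 0) (hf : parabolic_diffeo k a N f g)
    (he : 0 < e) :
  (forall V, attracting_petal k a N f V ->
     ~ analytic_on (fun z => complex_measure (eps_nbhd e (dyn_orbit f z))) V) /\
  (forall V, repelling_petal k a N f g V ->
     ~ analytic_on (fun z => complex_measure (eps_nbhd e (dyn_orbit g z))) V).
Proof.
split=> V pV.
  apply: (petal_not_analytic hk pV he) => [eps /(parabolic_expansion hf)[r r0 H]|].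
    by exists r => // z _; exact: H.
  by have [rho rho0 [_ _ _ fT]] := parabolic_near_id hk hf; exists rho => // z _; exact: fT.
have [gH [r r0 gT]] := inverse_expansion hk hf.
apply: (petal_not_analytic hk pV he) => [eps /gH[r' r'0 H]|].
  by exists r' => // z _; exact: H.
by exists r => // z _; exact: gT.
Qed.
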